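(* Let $K$ be a field, $S=K[x_1,\dots,x_n]$, $<$ a monomial order on $S$, and $I\subset S$ a graded ideal which is of König type with respect to $<$. Then the Cohen--Macaulayness of the initial ideal $\operatorname{in}_<(I)$ does not depend on the base field; that is, if $G$ is the minimal set of monomial generators of $\operatorname{in}_<(I)$, then for every field $K'$ the ring $K'[x_1,\dots,x_n]/(G)$ is Cohen--Macaulay if and only if $S/\operatorname{in}_<(I)$ is Cohen--Macaulay.
   Context: Let $I\subset S=K[x_1,\dots,x_n]$ be a graded ideal of height $h$ (standard grading) and $<$ a monomial order on $S$. $I$ is of König type with respect to $<$ if there is a sequence $f_1,\dots,f_h$ of homogeneous polynomials which forms part of a minimal system of generators of $I$ such that $\operatorname{in}_<(f_1),\dots,\operatorname{in}_<(f_h)$ is a regular sequence. Here $\operatorname{in}_<(f)$ is the initial monomial of $f$ and $\operatorname{in}_<(I)$ the initial ideal of $I$. *)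

(* Defs.v *)
From HB Require Import structures.
From mathcomp Require Import all_boot all_algebra.
From mathcomp Require boolp.
From mathcomp Require Import ring.
From mathcomp Require Import mpoly.

Set Implicit Arguments.
Unset Strict Implicit.
Unset Printing Implicit Defensive.

Import GRing.Theory.

Local Open Scope ring_scope.
Local Open Scope quotient_scope.

(* The ideals of [ring_quotient] are proper boolean predicates; the ones below
   may be the whole ring and are [Prop]-valued. *)

Record ideal (A : comPzRingType) := Ideal {
  ideal_mem :> A -> Prop;
  ideal_0 : ideal_mem 0;
  ideal_D : forall x y, ideal_mem x -> ideal_mem y -> ideal_mem (x + y);
  ideal_M : forall a x, ideal_mem x -> ideal_mem (a * x)
}.

Definition subideal (A : comPzRingType) (I J : ideal A) : Prop :=
  forall x, I x -> J x.

Definition strict_subideal (A : comPzRingType) (I J : ideal A) : Prop :=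
  subideal I J /\ ~ subideal J I.

Section IdealGen.
Variables (A : comPzRingType) (X : A -> Prop).

Let gen (x : A) : Prop :=
  forall J : ideal A, (forall y, X y -> J y) -> J x.

Let gen0 : gen 0.
Proof. by move=> J _; apply: ideal_0. Qed.

Let genD x y : gen x -> gen y -> gen (x + y).
Proof. by move=> gx gy J XJ; apply: ideal_D; [apply: gx | apply: gy]. Qed.

Let genM a x : gen x -> gen (a * x).
Proof. by move=> gx J XJ; apply: ideal_M; apply: gx. Qed.

Definition ideal_gen : ideal A := Ideal gen0 genD genM.

End IdealGen.

Definition ideal_seq (A : comPzRingType) (s : seq A) : ideal A :=
  ideal_gen (fun x => x \in s).

Definition generates (A : comPzRingType) (s : seq A) (I : ideal A) : Prop :=
  forall x, ideal_seq s x <-> I x.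

Definition noetherian (A : comPzRingType) : Prop :=
  forall I : ideal A, exists s : seq A, generates s I.

Definition maximal_ideal (A : comPzRingType) (M : ideal A) : Prop :=
  ~ M 1 /\ forall J : ideal A, subideal M J -> ~ J 1 -> subideal J M.

Record primeIdeal (A : comPzRingType) := PrimeIdeal {
  prime_ideal :> ideal A;
  prime_proper : ~ prime_ideal 1;
  prime_mul : forall x y,
    prime_ideal (x * y) -> prime_ideal x \/ prime_ideal y
}.

Section QuotientRing.
Variables (A : comPzRingType) (I : ideal A).

Definition ideal_pred : {pred A} := fun x => boolp.asbool (I x).

Lemma ideal_predP x : reflect (I x) (x \in ideal_pred).
Proof. exact: boolp.asboolP. Qed.

Lemma ideal_pred_zmod_closed : zmod_closed ideal_pred.
Proof.
split=> [|x y /ideal_predP Ix /ideal_predP Iy]; apply/ideal_predP.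
  exact: ideal_0.
by apply: ideal_D => //; rewrite -mulN1r; apply: ideal_M.
Qed.

HB.instance Definition _ :=
  GRing.isZmodClosed.Build A ideal_pred ideal_pred_zmod_closed.

Definition quotient_ring : Type := Quotient.quot ideal_pred.

HB.instance Definition _ := GRing.Zmodule.on quotient_ring.
HB.instance Definition _ := Quotient.on quotient_ring.

Implicit Types x y z : quotient_ring.

Definition quotient_one : quotient_ring := \pi_quotient_ring 1.
Definition quotient_mul := lift_op2 quotient_ring *%R.

Lemma quotient_eqP (a b : A) :
  reflect (\pi_quotient_ring a = \pi_quotient_ring b) (a - b \in ideal_pred).
Proof. by rewrite Quotient.idealrBE; apply: eqP. Qed.

Lemma quotient_mulE (a b : A) :
  quotient_mul (\pi a) (\pi b) = \pi_quotient_ring (a * b).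
Proof.
unlock quotient_mul.
apply/quotient_eqP/ideal_predP; set a' := repr _; set b' := repr _.
have /quotient_eqP/ideal_predP Ia : \pi_quotient_ring a' = \pi a.
  exact: reprK.
have /quotient_eqP/ideal_predP Ib : \pi_quotient_ring b' = \pi b.
  exact: reprK.
have -> : a' * b' - a * b = a' * (b' - b) + b * (a' - a).
  by rewrite !mulrBr addrA [b * a']mulrC subrK [b * a]mulrC.
by apply: ideal_D; apply: ideal_M.
Qed.

Lemma quotient_addE (a b : A) :
  \pi_quotient_ring a + \pi b = \pi_quotient_ring (a + b).
Proof. exact: esym (Quotient.pi_add _ a b). Qed.

Lemma quotient_mulA : associative quotient_mul.
Proof.
move=> x y z; rewrite -[x]reprK -[y]reprK -[z]reprK.
by rewrite !quotient_mulE mulrA.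
Qed.

Lemma quotient_mulC : commutative quotient_mul.
Proof.
by move=> x y; rewrite -[x]reprK -[y]reprK !quotient_mulE mulrC.
Qed.

Lemma quotient_mul1 : left_id quotient_one quotient_mul.
Proof. by move=> x; rewrite -[x]reprK quotient_mulE mul1r. Qed.

Lemma quotient_mulDl : left_distributive quotient_mul +%R.
Proof.
move=> x y z; rewrite -[x]reprK -[y]reprK -[z]reprK.
by rewrite !(quotient_addE, quotient_mulE) mulrDl.
Qed.

HB.instance Definition _ := GRing.Zmodule_isComPzRing.Build quotient_ring
  quotient_mulA quotient_mulC quotient_mul1 quotient_mulDl.

End QuotientRing.

(* Since [A] may have zero divisors, [a / s] and [b / t] are identified when
   [u * (a * t) = u * (b * s)] for some [u] outside [P]. *)

Section Localization.
Variables (A : comPzRingType) (P : primeIdeal A).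

Definition denominator : Type := {s : A | ~~ boolp.asbool (P s)}.
HB.instance Definition _ := Choice.on denominator.

Definition den_val (s : denominator) : A := val s.
Arguments den_val : simpl never.

Lemma denominatorP (s : denominator) : ~ P (den_val s).
Proof. by move/boolp.asboolPn: (valP s). Qed.

Definition mk_denominator (s : A) (Ps : ~ P s) : denominator :=
  exist _ s (introT (boolp.asboolPn _) Ps).

Lemma prime_mulN (x y : A) : ~ P x -> ~ P y -> ~ P (x * y).
Proof. by move=> Px Py /prime_mul[]. Qed.

Definition den_one : denominator := mk_denominator (@prime_proper A P).
Definition den_mul (s t : denominator) : denominator :=
  mk_denominator (prime_mulN (@denominatorP s) (@denominatorP t)).

Lemma den_val1 : den_val den_one = 1. Proof. by []. Qed.
Lemma den_valM s t : den_val (den_mul s t) = den_val s * den_val t.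
Proof. by []. Qed.

Definition fraction : Type := (A * denominator)%type.
HB.instance Definition _ := Choice.on fraction.

Implicit Types f g h : fraction.

Definition frac_eq f g : Prop :=
  exists2 u : A, ~ P u & u * (f.1 * den_val g.2) = u * (g.1 * den_val f.2).

Definition frac_eqb f g : bool := boolp.asbool (frac_eq f g).

Lemma frac_eqbP f g : reflect (frac_eq f g) (frac_eqb f g).
Proof. exact: boolp.asboolP. Qed.

Lemma frac_eqb_equiv : equiv_class_of frac_eqb.
Proof.
split.
- by move=> f; apply/frac_eqbP; exists 1 => //; apply: prime_proper.
- by move=> f g; apply/frac_eqbP/frac_eqbP=> -[u Pu e]; exists u.
- move=> g f h /frac_eqbP[u Pu e] /frac_eqbP[v Pv e']; apply/frac_eqbP.
  exists (u * v * den_val g.2).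
    by apply: prime_mulN (@denominatorP _); apply: prime_mulN.
  have -> : u * v * den_val g.2 * (f.1 * den_val h.2)
          = (u * (f.1 * den_val g.2)) * (v * den_val h.2) by ring.
  rewrite e.
  have -> : u * (g.1 * den_val f.2) * (v * den_val h.2)
          = (v * (g.1 * den_val h.2)) * (u * den_val f.2) by ring.
  by rewrite e'; ring.
Qed.

Canonical frac_eq_equiv := EquivRelPack frac_eqb_equiv.
Canonical frac_eq_encModRel := defaultEncModRel frac_eqb.

Definition localization : Type := {eq_quot frac_eqb}.
HB.instance Definition _ : EqQuotient fraction frac_eqb localization :=
  EqQuotient.on localization.
HB.instance Definition _ := Choice.on localization.

Implicit Types x y z : localization.

Definition frac_add f g : fraction :=
  (f.1 * den_val g.2 + g.1 * den_val f.2, den_mul f.2 g.2).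
Definition frac_opp f : fraction := (- f.1, f.2).
Definition frac_mul f g : fraction := (f.1 * g.1, den_mul f.2 g.2).

Definition loc_zero : localization := \pi_localization (0, den_one).
Definition loc_one : localization := \pi_localization (1, den_one).
Definition loc_add := lift_op2 localization frac_add.
Definition loc_opp := lift_op1 localization frac_opp.
Definition loc_mul := lift_op2 localization frac_mul.

Lemma loc_eqP f g :
  reflect (\pi_localization f = \pi_localization g) (frac_eqb f g).
Proof.
apply: (iffP idP) => [e|/eqP]; last by rewrite piE.
by apply/eqP; rewrite piE.
Qed.

Lemma loc_eq f g : frac_eq f g -> \pi_localization f = \pi_localization g.
Proof. by move/frac_eqbP/loc_eqP. Qed.

Lemma loc_repr f : frac_eq (repr (\pi_localization f)) f.
Proof. by apply/frac_eqbP/loc_eqP; rewrite reprK. Qed.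

Lemma loc_addE f g :
  loc_add (\pi f) (\pi g) = \pi_localization (frac_add f g).
Proof.
unlock loc_add; apply: loc_eq; move: (loc_repr f) (loc_repr g).
move: (repr _) (repr _) => g' f' [u Pu e] [v Pv e'].
exists (u * v); first exact: prime_mulN.
rewrite /= !den_valM.
have -> : u * v * ((f'.1 * den_val g'.2 + g'.1 * den_val f'.2) * (den_val f.2 * den_val g.2))
  = (u * (f'.1 * den_val f.2)) * (v * (den_val g'.2 * den_val g.2))
    + (v * (g'.1 * den_val g.2)) * (u * (den_val f'.2 * den_val f.2)) by ring.
by rewrite e e'; ring.
Qed.

Lemma loc_oppE f : loc_opp (\pi f) = \pi_localization (frac_opp f).
Proof.
unlock loc_opp; apply: loc_eq; move: (loc_repr f); move: (repr _) => f' [u Pu e].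
by exists u => //=; rewrite !mulNr !mulrN e.
Qed.

Lemma loc_mulE f g :
  loc_mul (\pi f) (\pi g) = \pi_localization (frac_mul f g).
Proof.
unlock loc_mul; apply: loc_eq; move: (loc_repr f) (loc_repr g).
move: (repr _) (repr _) => g' f' [u Pu e] [v Pv e'].
exists (u * v); first exact: prime_mulN.
rewrite /= !den_valM.
have -> : u * v * (f'.1 * g'.1 * (den_val f.2 * den_val g.2))
  = (u * (f'.1 * den_val f.2)) * (v * (g'.1 * den_val g.2)) by ring.
by rewrite e e'; ring.
Qed.

Let loc_eq1 f g :
  f.1 * den_val g.2 = g.1 * den_val f.2 -> \pi_localization f = \pi_localization g.
Proof.
by move=> e; apply: loc_eq; exists 1; [apply: prime_proper | rewrite e].
Qed.

Lemma loc_addA : associative loc_add.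
Proof.
move=> x y z; rewrite -[x]reprK -[y]reprK -[z]reprK !loc_addE.
by apply: loc_eq1; rewrite /= ?(den_valM, den_val1); ring.
Qed.

Lemma loc_addC : commutative loc_add.
Proof.
by move=> x y; rewrite -[x]reprK -[y]reprK !loc_addE; apply: loc_eq1; rewrite /= ?(den_valM, den_val1); ring.
Qed.

Lemma loc_add0 : left_id loc_zero loc_add.
Proof. by move=> x; rewrite -[x]reprK loc_addE; apply: loc_eq1; rewrite /= ?(den_valM, den_val1); ring. Qed.

Lemma loc_addN : left_inverse loc_zero loc_opp loc_add.
Proof.
by move=> x; rewrite -[x]reprK loc_oppE loc_addE; apply: loc_eq1; rewrite /= ?(den_valM, den_val1); ring.
Qed.

HB.instance Definition _ := GRing.isZmodule.Build localization
  loc_addA loc_addC loc_add0 loc_addN.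

Lemma loc_mulA : associative loc_mul.
Proof.
move=> x y z; rewrite -[x]reprK -[y]reprK -[z]reprK !loc_mulE.
by apply: loc_eq1; rewrite /= ?(den_valM, den_val1); ring.
Qed.

Lemma loc_mulC : commutative loc_mul.
Proof.
by move=> x y; rewrite -[x]reprK -[y]reprK !loc_mulE; apply: loc_eq1; rewrite /= ?(den_valM, den_val1); ring.
Qed.

Lemma loc_mul1 : left_id loc_one loc_mul.
Proof. by move=> x; rewrite -[x]reprK loc_mulE; apply: loc_eq1; rewrite /= ?(den_valM, den_val1); ring. Qed.

Lemma loc_mulDl : left_distributive loc_mul loc_add.
Proof.
move=> x y z; rewrite -[x]reprK -[y]reprK -[z]reprK.
by rewrite !(loc_addE, loc_mulE); apply: loc_eq1; rewrite /= ?(den_valM, den_val1); ring.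
Qed.

HB.instance Definition _ := GRing.Zmodule_isComPzRing.Build localization
  loc_mulA loc_mulC loc_mul1 loc_mulDl.

End Localization.

Definition is_max_nat (Q : nat -> Prop) (d : nat) : Prop :=
  Q d /\ forall k, Q k -> (k <= d)%N.

Definition is_min_nat (Q : nat -> Prop) (d : nat) : Prop :=
  Q d /\ forall k, Q k -> (d <= k)%N.

(* Only the terms p 0, ..., p k of p are relevant. *)
Definition prime_chain (A : comPzRingType) (p : nat -> primeIdeal A) (k : nat) :
    Prop :=
  forall i, (i < k)%N -> strict_subideal (p i) (p i.+1).

Definition krull_dim (A : comPzRingType) (d : nat) : Prop :=
  is_max_nat (fun k => exists p : nat -> primeIdeal A, prime_chain p k) d.

Definition prime_height (A : comPzRingType) (P : primeIdeal A) (h : nat) :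
    Prop :=
  is_max_nat (fun k => exists2 p : nat -> primeIdeal A,
    prime_chain p k & p k = P) h.

(* The unit ideal has no height, since no prime ideal contains it. *)
Definition ideal_height (A : comPzRingType) (I : ideal A) (h : nat) : Prop :=
  is_min_nat (fun k => exists2 P : primeIdeal A,
    subideal I P & prime_height P k) h.

Definition regular_sequence (A : comPzRingType) (s : seq A) : Prop :=
  ~ ideal_seq s 1 /\
  forall i x, (i < size s)%N ->
    ideal_seq (take i s) (s`_i * x) -> ideal_seq (take i s) x.

Definition is_depth (A : comPzRingType) (M : ideal A) (d : nat) : Prop :=
  is_max_nat (fun k => exists s : seq A,
    [/\ size s = k, forall x, x \in s -> M x & regular_sequence s]) d.

Definition local_ring (A : comPzRingType) (M : ideal A) : Prop :=
  maximal_ideal M /\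
  forall N : ideal A, maximal_ideal N -> forall x, N x <-> M x.

Definition local_cohen_macaulay (A : comPzRingType) : Prop :=
  exists (M : ideal A) (d : nat),
    [/\ local_ring M, is_depth M d & krull_dim A d].

Definition cohen_macaulay (A : comPzRingType) : Prop :=
  noetherian A /\
  forall M : primeIdeal A, maximal_ideal M ->
    local_cohen_macaulay (localization M).

(* [le] is the reflexive version of the order. *)
Record monomial_order (n : nat) (le : rel 'X_{1..n}) : Prop := MonomialOrder {
  mo_anti : antisymmetric le;
  mo_trans : transitive le;
  mo_total : total le;
  mo_le0 : forall u, le 0%MM u;
  mo_add : forall u v w, le u v -> le (u + w)%MM (v + w)%MM
}.

(* The largest monomial of f with respect to [le]; meaningless if f = 0. *)
Definition init_mon (n : nat) (le : rel 'X_{1..n}) (K : fieldType)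
    (f : {mpoly K[n]}) : 'X_{1..n} :=
  last 0%MM (sort le (msupp f)).

Definition init_ideal (n : nat) (le : rel 'X_{1..n}) (K : fieldType)
    (I : ideal {mpoly K[n]}) : ideal {mpoly K[n]} :=
  ideal_gen (fun g => exists f, [/\ I f, f != 0 & g = 'X_[init_mon le f]]).

Definition monomial_ideal (K : fieldType) (n : nat) (G : seq 'X_{1..n}) :
    ideal {mpoly K[n]} :=
  ideal_seq [seq 'X_[u] | u <- G].

Definition graded_ideal (K : fieldType) (n : nat) (I : ideal {mpoly K[n]}) :
    Prop :=
  forall f d, I f -> I (pihomog mdeg d f).

Definition minimal_generators (A : comPzRingType) (s : seq A) (I : ideal A) :
    Prop :=
  generates s I /\ forall t, subseq t s -> generates t I -> t = s.

(* As usual for graded ideals, all the members of the minimal system of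
   generators are homogeneous. *)
Definition konig_type (K : fieldType) (n : nat) (le : rel 'X_{1..n})
    (I : ideal {mpoly K[n]}) : Prop :=
  exists (h : nat) (fs gs : seq {mpoly K[n]}),
    [/\ ideal_height I h,
        size fs = h,
        all (fun f => f \is homog mdeg) (fs ++ gs),
        minimal_generators (fs ++ gs) I &
        regular_sequence
          [seq 'X_[init_mon le f] : {mpoly K[n]} | f <- fs]].

(* Main.v *)
From HB Require Import structures.
Require Import Defs.
From mathcomp Require Import all_boot all_order all_algebra.
From mathcomp Require boolp.
From mathcomp Require Import ring zify.
From mathcomp Require Import mpoly.

Set Implicit Arguments.
Unset Strict Implicit.
Unset Printing Implicit Defensive.

Import Order.TTheory GRing.Theory.
Local Open Scope ring_scope.

(** Let [J] be the initial ideal and [d = n - h].  The initial monomials of the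
    polynomials [f_1, ..., f_h] form a regular sequence inside [J], so their supports
    are nonempty and pairwise disjoint; they extend to a partition of the variables
    into [h] blocks, each with a chosen representative [x_(rho a)].  Identifying the
    variables of every block, that is, dividing by the [d] linear forms
    [x_a - x_(rho a)], turns [J] into a monomial ideal that contains a power of each
    representative.  As [S / J] has dimension [d], these forms are a system of
    parameters, and [S / J] is Cohen--Macaulay if and only if it is free over the
    polynomial ring that they generate.

    Freeness is a matter of counting.  Products of powers of the linear forms with
    the monomials in the representatives that stay outside the identified ideal span
    [S / J] over any field ([reduced_span]), while the monomials outside [J] are a
    basis of [S / J].  So freeness holds exactly when, in each range of degrees, the
    spanning family is no larger than this basis ([reduced_free_count] and
    [count_reduced_free]), and both numbers depend only on the monomials.

    Three facts of commutative algebra connect this with the definition of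
    Cohen--Macaulayness through all localizations.

    - If the localization at the origin is Cohen--Macaulay, the linear forms are
      regular there ([variables_regular]).  Suppose that the next form [w] is a zero
      divisor modulo the previous ones.  It lies in an associated prime, which also
      contains a variable of each block, so few variables generate the ring modulo this
      prime.  But a regular sequence of length [k] forces [k] strict inclusions above
      every associated prime ([regular_chain_above]), and dividing by a regular
      element leaves a regular sequence only one shorter ([regular_quotient]), by the
      usual exchange of regular elements.
    - Freeness over a polynomial ring gives Cohen--Macaulay localizations at every
      prime [M], graded or not ([local_parameters], [free_local_cohen_macaulay]).  If
      [V] is a maximal set of parameters algebraically independent modulo [M], each
      other parameter [w] satisfies a polynomial equation over [V] modulo [M]; these
      [d - #|V|] polynomials are regular at [M] because divisibility by them can be
      tested on coefficients.
    - Lengths of chains of primes are bounded above by algebraic dependence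
      ([chain_dimension]) and below by regular sequences ([regular_chain]).

    It remains that [S / J] has dimension [d], although only the height [h] of [I] is
    given.  A prime [P] of height [h] above [I] has at least [n - h] variables that
    are independent modulo [P] ([independent_height]), hence modulo [I]; comparing
    the growth of [S / I] and of [S / J] gives as many variables that are independent
    modulo [J] ([init_independent]). *)

(** * Ideals and chains of primes *)

Section Ideals.
Variable A : comPzRingType.
Implicit Types (I J N : ideal A) (x y : A) (s : seq A).

Lemma ideal_ext I J : (forall x, I x <-> J x) -> I = J.
Proof.
case: I J => [I I0 ID IM] [J J0 JD JM] /= IJ.
have e : I = J by apply: boolp.funext => x; apply: boolp.propext.
by subst J; congr Ideal; apply: boolp.Prop_irrelevance.
Qed.

Lemma ideal_Mr I a x : I x -> I (x * a).
Proof. by rewrite mulrC; apply: ideal_M. Qed.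

Lemma ideal_N I x : I x -> I (- x).
Proof. by rewrite -mulN1r; apply: ideal_M. Qed.

Lemma ideal_B I x y : I x -> I y -> I (x - y).
Proof. by move=> Ix Iy; apply: ideal_D => //; apply: ideal_N. Qed.

Lemma ideal_DKr I x y : I x -> I (x + y) -> I y.
Proof. by move=> Ix Ixy; have := ideal_B Ixy Ix; rewrite addrAC subrr add0r. Qed.

Lemma ideal_DKl I x y : I y -> I (x + y) -> I x.
Proof. by rewrite addrC; apply: ideal_DKr. Qed.

Lemma ideal_sum I (T : Type) (r : seq T) (P : pred T) (F : T -> A) :
  (forall i, P i -> I (F i)) -> I (\sum_(i <- r | P i) F i).
Proof. by move=> IF; elim/big_ind: _ => // [|x y]; [apply: ideal_0 | apply: ideal_D]. Qed.

Lemma ideal_unit I a x : a * x = 1 -> I x -> forall y, I y.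
Proof. by move=> ax Ix y; rewrite -[y]mulr1 -ax mulrA; apply: ideal_M. Qed.

Lemma prime_exp (P : primeIdeal A) x k : P (x ^+ k) -> P x.
Proof.
elim: k => [|k IHk]; first by rewrite expr0 => /(@prime_proper _ P).
by rewrite exprS => /(@prime_mul _ P)[].
Qed.

Lemma prime_prod (P : primeIdeal A) (T : Type) (r : seq T) (F : T -> A) :
  P (\prod_(i <- r) F i) -> exists i, P (F i).
Proof.
elim: r => [|i r IHr]; first by rewrite big_nil => /(@prime_proper _ P).
by rewrite big_cons => /(@prime_mul _ P)[Pi|/IHr //]; exists i.
Qed.

Lemma zero_ideal_D x y : x = 0 -> y = 0 -> x + y = 0.
Proof. by move=> -> ->; rewrite addr0. Qed.

Lemma zero_ideal_M a x : x = 0 -> a * x = 0.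
Proof. by move=> ->; rewrite mulr0. Qed.

Definition zero_ideal : ideal A := Ideal (erefl 0) zero_ideal_D zero_ideal_M.

Section AddIdeal.
Variables (N : ideal A) (x : A).

Let mem y := exists2 a, N a & exists b, y = a + b * x.

Let mem0 : mem 0.
Proof. by exists 0; [apply: ideal_0 | exists 0; rewrite mul0r addr0]. Qed.

Let memD y z : mem y -> mem z -> mem (y + z).
Proof.
move=> [a Na [b ->]] [c Nc [d ->]]; exists (a + c); first exact: ideal_D.
by exists (b + d); ring.
Qed.

Let memM c y : mem y -> mem (c * y).
Proof.
move=> [a Na [b ->]]; exists (c * a); first exact: ideal_M.
by exists (c * b); ring.
Qed.

Definition add_ideal : ideal A := Ideal mem0 memD memM.
End AddIdeal.

Lemma sub_add_ideal N x : subideal N (add_ideal N x).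
Proof. by move=> a Na; exists a => //; exists 0; rewrite mul0r addr0. Qed.

Lemma mem_add_ideal N x : add_ideal N x x.
Proof. by exists 0; [apply: ideal_0 | exists 1; rewrite mul1r add0r]. Qed.

Lemma add_ideal_le N I x : subideal N I -> I x -> subideal (add_ideal N x) I.
Proof. by move=> NI Ix y [a Na [b ->]]; apply: ideal_D; [apply: NI | apply: ideal_M]. Qed.

Lemma add_idealC N x y : add_ideal (add_ideal N x) y = add_ideal (add_ideal N y) x.
Proof.
by apply: ideal_ext => z; split; apply: add_ideal_le; try apply: add_ideal_le;
  (try by apply: mem_add_ideal); try (by apply: sub_add_ideal; apply: mem_add_ideal);
  move=> t Nt; do 2 apply: sub_add_ideal.
Qed.

Definition add_ideals N s : ideal A := foldl add_ideal N s.

Lemma sub_add_ideals N s : subideal N (add_ideals N s).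
Proof.
elim: s N => [|x s IHs] N y Ny //=; apply: IHs; exact: sub_add_ideal.
Qed.

Lemma mem_add_ideals N s x : x \in s -> add_ideals N s x.
Proof.
elim: s N => [|y s IHs] N //=; rewrite inE => /predU1P[->|/IHs //].
by apply: sub_add_ideals; apply: mem_add_ideal.
Qed.

Lemma add_ideals_le N s I : subideal N I -> (forall x, x \in s -> I x) ->
  subideal (add_ideals N s) I.
Proof.
elim: s N => [|x s IHs] N NI sI //=; apply: IHs.
  by apply: add_ideal_le => //; apply: sI; rewrite mem_head.
by move=> y ys; apply: sI; rewrite inE ys orbT.
Qed.

Lemma mem_ideal_gen (X : A -> Prop) x : X x -> ideal_gen X x.
Proof. by move=> Xx; rewrite /ideal_gen /= => J; apply. Qed.

Lemma ideal_gen_le (X : A -> Prop) I :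
  (forall x, X x -> I x) -> subideal (ideal_gen X) I.
Proof. by move=> XI x; rewrite /ideal_gen /=; apply. Qed.

Lemma add_ideals0 s : add_ideals zero_ideal s = ideal_seq s.
Proof.
apply: ideal_ext => x; split.
  apply: add_ideals_le => [y -> |y ys]; first exact: ideal_0.
  exact: mem_ideal_gen.
by apply; exact: mem_add_ideals.
Qed.

Definition nonzerodivisor_mod N x : Prop := forall y, N (x * y) -> N y.

(** Regular sequences on the quotient by [N], by recursion on the sequence and
    without properness, so that the tail of a regular sequence is again regular,
    modulo a larger ideal. *)
Fixpoint regular_mod N s : Prop :=
  if s is x :: s' then nonzerodivisor_mod N x /\ regular_mod (add_ideal N x) s'
  else True.

Lemma regular_mod_nth N s : regular_mod N s <->
  forall i y, (i < size s)%N -> add_ideals N (take i s) (s`_i * y) ->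
    add_ideals N (take i s) y.
Proof.
elim: s N => [|x s IHs] N //=; split.
  by move=> [Nx /IHs rs] [|i] y /=; [move=> _; apply: Nx | apply: rs].
move=> rs; split; first by move=> y; apply: (rs 0%N y).
by apply/IHs => i y; apply: (rs i.+1).
Qed.

Lemma regular_sequenceE s :
  regular_sequence s <-> ~ ideal_seq s 1 /\ regular_mod zero_ideal s.
Proof.
split=> -[s1 rs]; split=> //; first apply/regular_mod_nth => i y si.
  by rewrite !add_ideals0; apply: rs.
by move=> i y si; rewrite -!add_ideals0; apply: (proj1 (regular_mod_nth _ _) rs).
Qed.

Lemma regular_mod_cat N s t : regular_mod N (s ++ t) <->
  regular_mod N s /\ regular_mod (add_ideals N s) t.
Proof.
elim: s N => [|x s IHs] N /=; first by split=> [|[]].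
by split=> [[xr /IHs[]]|[[xr rs] rt]] //; split=> //; apply/IHs.
Qed.

(** Regularity in the local ring at [M], without fractions: an element of the
    ring lies in the localized ideal when some [u] outside [M] multiplies it into
    the ideal. *)
Fixpoint locally_regular (M : A -> Prop) N s : Prop :=
  if s is x :: s' then
    (forall y, N (x * y) -> exists2 u, ~ M u & N (u * y)) /\
    locally_regular M (add_ideal N x) s'
  else True.

Lemma locally_regular_rcons M N s x : locally_regular M N (rcons s x) <->
  locally_regular M N s /\
  (forall y, add_ideals N s (x * y) -> exists2 u, ~ M u & add_ideals N s (u * y)).
Proof.
elim: s N => [|z s IHs] N /=; first by split=> -[].
by split=> [[zr /IHs[]]|[[zr rs] rt]] //; split=> //; apply/IHs.
Qed.

Lemma locally_regularS (M M' : A -> Prop) N s : (forall x, M' x -> M x) ->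
  locally_regular M N s -> locally_regular M' N s.
Proof.
move=> MM'; elim: s N => [|x s IHs] N //= [rx rs]; split; last exact: IHs.
by move=> y /rx[u Mu Nu]; exists u => // /MM'.
Qed.

End Ideals.

Lemma prime_chain_mono (A : comPzRingType) (p : nat -> primeIdeal A) k i j :
  prime_chain p k -> (i <= j)%N -> (j <= k)%N -> subideal (p i) (p j).
Proof.
move=> pc; elim: j => [|j IHj] ij jk x; first by move: ij; case: i.
move: ij; rewrite leq_eqVlt => /predU1P[<- //|ij] px.
by have [le _] := pc j jk; apply: le; apply: IHj px => //; apply: ltnW.
Qed.

Section Noetherian.
Variable A : comPzRingType.
Hypothesis noethA : noetherian A.
Implicit Types (I J N : ideal A) (x y : A) (s : seq A).

Section AscendingUnion.
Variable (f : nat -> ideal A).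
Hypothesis f_le : forall k, subideal (f k) (f k.+1).

Let f_mono k l : (k <= l)%N -> subideal (f k) (f l).
Proof.
move=> kl; rewrite -(subnKC kl); elim: (l - k)%N => [|m IHm] x fx.
  by rewrite addn0.
by rewrite addnS; apply: f_le; apply: IHm.
Qed.

Let mem x := exists k, f k x.

Let mem0 : mem 0. Proof. by exists 0%N; apply: ideal_0. Qed.

Let memD x y : mem x -> mem y -> mem (x + y).
Proof.
move=> [k fx] [l fy]; exists (maxn k l).
by apply: ideal_D; [apply: f_mono fx | apply: f_mono fy]; rewrite ?leq_maxl ?leq_maxr.
Qed.

Let memM a x : mem x -> mem (a * x).
Proof. by move=> [k fx]; exists k; apply: ideal_M. Qed.

Lemma chain_stationary : exists k, subideal (f k.+1) (f k).
Proof.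
have [s gen_s] := noethA (Ideal mem0 memD memM).
have [k fs] : exists k, forall x, x \in s -> f k x.
  have : forall x, x \in s -> mem x.
    by move=> x xs; apply/gen_s; apply: mem_ideal_gen.
  elim: s {gen_s} => [|x s IHs] sm; first by exists 0%N.
  have [k fx] : mem x by apply: sm; rewrite mem_head.
  have [|l fl] := IHs; first by move=> y ys; apply: sm; rewrite inE ys orbT.
  exists (maxn k l) => y; rewrite inE => /predU1P[->|ys].
    by apply: f_mono fx; rewrite leq_maxl.
  by apply: f_mono (fl y ys); rewrite leq_maxr.
exists k => x fx; have /gen_s := ex_intro (fun k => f k x) _ fx.
by apply.
Qed.

End AscendingUnion.

Lemma noetherian_max (F : ideal A -> Prop) I0 : F I0 ->
  exists I, [/\ subideal I0 I, F I & forall J, F J -> subideal I J -> subideal J I].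
Proof.
move=> FI0; apply: boolp.contrapT => nomax.
have step : forall I, exists J, F I -> subideal I0 I ->
    [/\ F J, subideal I J & ~ subideal J I].
  move=> I; apply: boolp.contrapT => noJ; apply: nomax; exists I.
  have [[FI I0I]|nF] := boolp.EM (F I /\ subideal I0 I).
    split=> // J FJ IJ; apply: boolp.contrapT => JI.
    by apply: noJ; exists J.
  by case: noJ; exists I0 => FI I0I; case: nF.
have [f fP] := boolp.choice step.
pose g k := iter k f I0.
have gP k : F (g k) /\ subideal I0 (g k).
  elim: k => [|k [Fk I0k]] /=; first by split=> // x.
  have [Ff gf _] := fP _ Fk I0k.
  by split=> // x /I0k; apply: gf.
have gf k : subideal (g k) (g k.+1) by have [Fk I0k] := gP k; have [] := fP _ Fk I0k.
have [k gk] := chain_stationary gf.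
by have [Fk I0k] := gP k; have [_ _] := fP _ Fk I0k.
Qed.

(** An ideal maximal among those disjoint from [T] is prime. *)
Lemma prime_avoiding (T : A -> Prop) I :
  T 1 -> (forall x y, T x -> T y -> T (x * y)) -> (forall x, I x -> ~ T x) ->
  exists2 P : primeIdeal A, subideal I P & forall x, P x -> ~ T x.
Proof.
move=> T1 TM IT.
have [P [IP PT Pmax]] := noetherian_max (F := fun J => forall x, J x -> ~ T x) IT.
have P1 : ~ P 1 by move/PT.
have meetT z : ~ P z -> exists2 t, T t & add_ideal P z t.
  move=> Pz; apply: boolp.contrapT => noT; apply: Pz.
  apply: (Pmax (add_ideal P z)); last exact: mem_add_ideal.
    by move=> t Pt Tt; apply: noT; exists t.
  exact: sub_add_ideal.
have PM x y : P (x * y) -> P x \/ P y.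
  move=> Pxy; apply: boolp.contrapT => /boolp.not_orP[/meetT[t Tt [a Pa [b te]]]].
  move=> /meetT[t' Tt' [a' Pa' [b' te']]].
  apply: (PT (t * t')); last exact: TM.
  have -> : t * t' = t' * a + (b * x) * a' + (b * b') * (x * y).
    by rewrite te te'; ring.
  by do 2?apply: ideal_D; apply: ideal_M.
by exists (PrimeIdeal P1 PM).
Qed.

(** Multiplying elements outside the prime by powers of the last member of the
    sequence never reaches the ideal of the previous members, so some prime below
    contains those and avoids that member; this gives the top step of the chain. *)
Lemma regular_chain (P : primeIdeal A) N s :
  subideal N P -> (forall x, x \in s -> P x) -> locally_regular P N s ->
  exists p : nat -> primeIdeal A,
    [/\ prime_chain p (size s), p (size s) = P & subideal N (p 0%N)].
Proof.
elim/last_ind: s P => [|s x IHs] P NP sP; first by exists (fun=> P).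
move=> /locally_regular_rcons[rs rx].
pose T z := exists u k, ~ P u /\ z = u * x ^+ k.
have [||z Nz [u [k [Pu ze]]]|Q NQ QT] := @prime_avoiding T (add_ideals N s).
- by exists 1, 0%N; split; [apply: prime_proper | rewrite mulr1].
- move=> _ _ [u [k [Pu ->]]] [v [l [Pv ->]]]; exists (u * v), (k + l)%N; split.
    by move=> /(@prime_mul _ P)[].
  by rewrite exprD; ring.
- have sN : subideal (add_ideals N s) P.
    by apply: add_ideals_le => // y ys; apply: sP; rewrite mem_rcons inE ys orbT.
  elim: k u Pu z {Nz} ze (Nz) => [|k IHk] u Pu _ -> Nz.
    by apply/Pu/sN; rewrite -[u]mulr1.
  move: Nz; rewrite exprS mulrCA => /rx[v Pv Nv].
  apply: (IHk (v * u)) (erefl _) _; last by rewrite -mulrA.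
  by move=> /(@prime_mul _ P)[].
have QP : subideal Q P.
  move=> y Qy; apply: boolp.contrapT => Py; apply: (QT y Qy).
  by exists y, 0%N; rewrite mulr1.
have Qx : ~ Q x.
  by move=> /QT; apply; exists 1, 1%N; split; [apply: prime_proper | rewrite mul1r].
have [|||p [pc pe Np]] := IHs Q.
- by move=> y Ny; apply: NQ; apply: sub_add_ideals.
- by move=> y ys; apply: NQ; apply: mem_add_ideals.
- by apply: locally_regularS rs => y /QP.
exists (fun i => if (i <= size s)%N then p i else P); rewrite size_rcons; split.
- move=> i; rewrite ltnS => le_is; rewrite le_is; case: ltnP => [/pc //|si].
  have -> : i = size s by apply/eqP; rewrite eqn_leq le_is.
  rewrite pe; split=> // /(_ x) PQ; apply: Qx; apply: PQ; apply: sP.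
  by rewrite mem_rcons mem_head.
- by rewrite ltnn.
- by [].
Qed.

End Noetherian.

(** * Associated primes and exchange of regular elements *)

Section AssociatedPrimes.
Variable A : comPzRingType.
Hypothesis noethA : noetherian A.
Implicit Types (I J N : ideal A) (x y z : A) (s : seq A) (P : primeIdeal A).

Definition associated N P : Prop := exists2 z, ~ N z & forall x, P x <-> N (x * z).

Section Colon.
Variables (N : ideal A) (z : A).

Let mem0 : N (0 * z). Proof. by rewrite mul0r; apply: ideal_0. Qed.

Let memD x y : N (x * z) -> N (y * z) -> N ((x + y) * z).
Proof. by rewrite mulrDl; apply: ideal_D. Qed.

Let memM a x : N (x * z) -> N ((a * x) * z).
Proof. by rewrite -mulrA; apply: ideal_M. Qed.

Definition colon : ideal A := Ideal mem0 memD memM.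
End Colon.

(** A maximal annihilator of a nonzero element of [A / N] is prime. *)
Lemma associated_above N y : ~ N y ->
  exists2 P, associated N P & subideal (colon N y) P.
Proof.
move=> Ny.
have [|J [yJ [z Nz Jz] Jmax]] := noetherian_max noethA
  (F := fun J => exists2 z, ~ N z & forall x, J x <-> N (x * z)) (I0 := colon N y).
  by exists y.
have J1 : ~ J 1 by move/Jz; rewrite mul1r.
have JM x t : J (x * t) -> J x \/ J t.
  move=> Jxt; have [|Jt] := boolp.EM (J t); [by right | left].
  apply: (Jmax (colon N (t * z))) => /=.
  - by exists (t * z) => // /Jz.
  - by move=> a /Jz Na /=; rewrite mulrCA; apply: ideal_M.
  - by rewrite mulrA; apply/Jz.
by exists (PrimeIdeal J1 JM) => //; exists z.
Qed.

Definition same_ideal (I J : A -> Prop) : Prop := forall x, I x <-> J x.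

(** If [P1] is the annihilator of [z1] in [A / N], every associated prime of [N]
    is [P1] or is associated to [N + z1]; Noetherian induction concludes.  The prime
    [P0] is the default value of the enumeration. *)
Lemma associated_finite (P0 : primeIdeal A) N : exists k (L : nat -> primeIdeal A),
  forall P, associated N P -> exists2 i, (i < k)%N & same_ideal (L i) P.
Proof.
pose fin I := exists k (L : nat -> primeIdeal A),
  forall P, associated I P -> exists2 i, (i < k)%N & same_ideal (L i) P.
apply: boolp.contrapT => Nfin.
have {N Nfin}[I [_ Ifin Imax]] := noetherian_max noethA (F := fun I => ~ fin I) Nfin.
have [z0 Iz0] : exists z, ~ I z.
  apply: boolp.contrapT => noz; apply: Ifin; exists 0%N, (fun=> P0) => P [z Iz].
  by case: noz; exists z.
have [P1 [z1 Iz1 P1E] _] := associated_above Iz0.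
have [k [L LP]] : fin (add_ideal I z1).
  apply: boolp.contrapT => /Imax/(_ (@sub_add_ideal _ I z1)).
  by move=> /(_ z1 (mem_add_ideal _ _)).
apply: Ifin; exists k.+1, (fun i => if i is j.+1 then L j else P1).
move=> P [x Ix PE].
(* Either some multiple of [x] outside [I] falls into [I + z1], and then [P] is the
   annihilator of [z1], or the annihilator of [x] is the same modulo [I + z1]. *)
have [[b Pb [a Ia [c e]]]|nob] :=
  boolp.EM (exists2 b, ~ P b & add_ideal I z1 (b * x)).
  have Ibx : ~ I (b * x) by move/PE.
  have P1c : ~ P1 c by move/P1E => Icz; apply: Ibx; rewrite e; apply: ideal_D.
  exists 0%N => // y; split=> [/P1E Iyz|/PE Iyx].
    have /PE/(@prime_mul _ P)[//|//] : I ((y * b) * x).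
    rewrite -mulrA e mulrDr mulrCA.
    by apply: ideal_D; apply: ideal_M.
  have /P1E/(@prime_mul _ P1)[//|//] : I ((y * c) * z1).
  have : I (b * (y * x)) by apply: ideal_M.
  by rewrite mulrCA e mulrDr mulrA; apply: ideal_DKr; apply: ideal_M.
have [|i ik Li] := LP P; last by exists i.+1.
exists x => [I'x|y].
  by apply: nob; exists 1; [apply: prime_proper | rewrite mul1r].
split=> [/PE|I'yx]; first exact: sub_add_ideal.
by apply: boolp.contrapT => Py; apply: nob; exists y.
Qed.

(** The conclusion exempts the primes that contain [M], so that a prime contained
    in a later one can be replaced by the latter in the induction. *)
Lemma prime_avoidance (M : ideal A) k (L : nat -> primeIdeal A) :
  exists2 c, M c & forall i, (i < k)%N -> ~ subideal M (L i) -> ~ L i c.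
Proof.
elim: k L => [|k IHk] L; first by exists 0 => //; apply: ideal_0.
have [c Mc Lc] := IHk L.
have [ML|ML] := boolp.EM (subideal M (L k)).
  exists c => // i; rewrite ltnS leq_eqVlt => /predU1P[-> //|]; exact: Lc.
have [Lkc|Lkc] := boolp.EM (L k c); last first.
  by exists c => // i; rewrite ltnS leq_eqVlt => /predU1P[-> //|]; exact: Lc.
have [[i0 [ik ML0 L0]]|noi] :=
  boolp.EM (exists i, [/\ (i < k)%N, ~ subideal M (L i) & subideal (L i) (L k)]).
  have [c' Mc' Lc'] := IHk (fun i => if i == i0 then L k else L i).
  have Lkc' : ~ L k c' by have := Lc' _ ik; rewrite eqxx; apply.
  exists c' => // i; rewrite ltnS leq_eqVlt => /predU1P[-> //|ltik].
  case: (eqVneq i i0) => [-> _ /L0 //|nei].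
  by have := Lc' _ ltik; rewrite (negPf nei).
have [|z zP] := boolp.choice (P := fun i z => (i < k)%N ->
    ~ L k z /\ (~ subideal M (L i) -> L i z)).
  move=> i; apply: boolp.contrapT => noz.
  have [ltik|?] := boolp.EM (i < k)%N; last by apply: noz; exists 0.
  have [MLi|MLi] := boolp.EM (subideal M (L i)).
    by apply: noz; exists 1 => _; split=> //; apply: prime_proper.
  apply: noi; exists i; split=> // x Lx; apply: boolp.contrapT => Lkx.
  by apply: noz; exists x.
have [y My Lky] : exists2 y, M y & ~ L k y.
  apply: boolp.contrapT => noy; apply: ML => y My.
  by apply: boolp.contrapT => Lky; apply: noy; exists y.
exists (c + y * \prod_(i < k) z i).
  by apply: ideal_D => //; apply: ideal_Mr.
move=> i; rewrite ltnS leq_eqVlt => /predU1P[-> _ /(ideal_DKr Lkc)|ltik MLi].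
  move=> /(@prime_mul _ (L k))[//|/(@prime_prod _ (L k))[j]].
  by case: (zP j).
move=> Lic; apply: (Lc i ltik MLi); apply: ideal_DKl Lic; apply: ideal_M.
rewrite (bigD1 (Ordinal ltik)) //=; apply: ideal_Mr.
by case: (zP i ltik) => _; apply.
Qed.

(** The zero divisors modulo [N] make up the associated primes of [N]; none of
    them contains [M] as soon as [M] has one nonzerodivisor. *)
Lemma common_nonzerodivisor (P0 : primeIdeal A) (M : ideal A) (Ns : seq (ideal A)) :
  (forall i, (i < size Ns)%N ->
     exists2 c, M c & nonzerodivisor_mod (nth (zero_ideal A) Ns i) c) ->
  exists2 c, M c & forall i, (i < size Ns)%N ->
     nonzerodivisor_mod (nth (zero_ideal A) Ns i) c.
Proof.
move=> Mreg.
have [k [L LP]] : exists k (L : nat -> primeIdeal A),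
    forall i P, (i < size Ns)%N -> associated (nth (zero_ideal A) Ns i) P ->
    exists2 j, (j < k)%N & same_ideal (L j) P.
  elim: Ns {Mreg} => [|N Ns [k [L LP]]]; first by exists 0%N, (fun=> P0).
  have [k' [L' LP']] := associated_finite P0 N.
  exists (k + k')%N, (fun j => if (j < k)%N then L j else L' (j - k)%N).
  move=> [|i] P /=; last first.
    rewrite ltnS => iN /(LP i P iN)[j jk LjP].
    by exists j; rewrite ?jk // ltn_addr.
  move=> _ /LP'[j jk LjP]; exists (j + k)%N; first by rewrite addnC ltn_add2l.
  by rewrite ltnNge leq_addl addnK.
have [c Mc Lc] := prime_avoidance M k L.
exists c => // i iN y Ncy; apply: boolp.contrapT => Ny.
have [P aP colonP] := associated_above Ny.
have [j jk LP'] := LP i P iN aP.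
apply: (Lc j jk) => [ML|]; last by apply/LP'; apply: colonP.
have [d Md Nd] := Mreg i iN; have [z Nz PE] := aP.
by apply/Nz/Nd/PE/LP'/ML.
Qed.

(** If [M] consists of zero divisors, prime avoidance puts it inside a single
    associated prime. *)
Lemma socle_or_nonzerodivisor (P0 : primeIdeal A) (M : ideal A) N :
  ~ (exists2 c, M c & nonzerodivisor_mod N c) ->
  exists2 z, ~ N z & forall m, M m -> N (m * z).
Proof.
move=> noc; have [k [L LP]] := associated_finite P0 N.
have [c Mc Lc] := prime_avoidance M k L.
have [y Ncy Ny] : exists2 y, N (c * y) & ~ N y.
  apply: boolp.contrapT => noy; apply: noc; exists c => // y Ncy.
  by apply: boolp.contrapT => Ny; apply: noy; exists y.
have [P [z Nz PE] colonP] := associated_above Ny.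
have [|j jk LPE] := LP P; first by exists z.
exists z => // m Mm; apply/PE/LPE; move: m Mm.
apply: boolp.contrapT => /(Lc j jk); apply; apply/LPE; exact: colonP.
Qed.

(** The annihilator of [M] in [A / N + x] does not depend, up to isomorphism,
    on the element [x] of [M] that is regular modulo [N]; hence neither does the
    existence of a further regular element. *)
Lemma nonzerodivisor_exchange (P0 : primeIdeal A) (M : ideal A) N x y f :
  M x -> nonzerodivisor_mod N x -> nonzerodivisor_mod N y ->
  M f -> nonzerodivisor_mod (add_ideal N x) f ->
  exists2 c, M c & nonzerodivisor_mod (add_ideal N y) c.
Proof.
move=> Mx Nx Ny Mf Nf; apply: boolp.contrapT.
move=> /(socle_or_nonzerodivisor P0)[z N'z Mz].
have [a Na [w xz]] := Mz x Mx.
have N'w : ~ add_ideal N x w.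
  move=> [b Nb [v we]]; apply: N'z.
  have : N (x * (z - v * y)).
    have -> : x * (z - v * y) = a + y * b by rewrite mulrBr xz we; ring.
    by apply: ideal_D => //; apply: ideal_M.
  by move/Nx => Nzv; exists (z - v * y) => //; exists v; ring.
apply/N'w/Nf.
have [b Nb [v fz]] := Mz f Mf.
have : N (y * (f * w - v * x)).
  have -> : y * (f * w - v * x) = x * b - f * a.
    have -> : y * (f * w - v * x) = f * (x * z) - f * a - x * (f * z) + x * b.
      by rewrite xz fz; ring.
    by ring.
  by apply: ideal_B; apply: ideal_M.
by move/Ny => Nfw; exists (f * w - v * x) => //; exists v; ring.
Qed.

(** From [x * z = y * b] modulo [N], regularity of [y] makes [b] a multiple of [x],
    and [x] cancels. *)
Lemma nonzerodivisor_swap N x y : nonzerodivisor_mod N x ->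
  nonzerodivisor_mod (add_ideal N x) y -> nonzerodivisor_mod (add_ideal N y) x.
Proof.
move=> Nx Ny z [a Na [b xz]].
have [c Nc [d be]] : add_ideal N x b.
  by apply: Ny; exists (- a); [apply: ideal_N | exists z; rewrite [z * x]mulrC xz; ring].
exists (z - d * y); last by exists d; ring.
apply: Nx; have -> : x * (z - d * y) = a + y * c by rewrite mulrBr xz be; ring.
by apply: ideal_D => //; apply: ideal_M.
Qed.

(** The sequence [f1, ...] and [x] are linked by an element [c] regular modulo each
    of [N], [N + x] and [N + f1]: by induction [N + f1 + c] has a regular sequence of
    length [k - 2], so [N + c] has one of length [k - 1], to which the induction
    applies again with [x]. *)
Lemma regular_quotient (P0 : primeIdeal A) (M : ideal A) s N x :
  (forall f, f \in s -> M f) -> regular_mod N s -> M x -> nonzerodivisor_mod N x ->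
  exists t, [/\ size t = (size s).-1, forall f, f \in t -> M f
                & regular_mod (add_ideal N x) t].
Proof.
elim: {s}(size s) {-2}s (erefl (size s)) N x => [|k IHk] s.
  by move=> /size0nil -> N x _ _ _ _; exists [::].
case: s => [|f1 [|f2 s]] //= [sk] N x Ms [Nf1 Ns] Mx Nx; first by exists [::].
have Mf1 : M f1 by apply: Ms; rewrite mem_head.
have Mf2 : M f2 by apply: Ms; rewrite !inE eqxx orbT.
case: Ns => Nf2 Ns.
have [|c Mc Nc] := @common_nonzerodivisor P0 M [:: N; add_ideal N x; add_ideal N f1].
  case=> [|[|[|i]]] //= _; first by exists x.
    exact: nonzerodivisor_exchange Mf1 Nf1 Nx Mf2 Nf2.
  by exists f2.
have [N0c Nxc Nfc] : [/\ nonzerodivisor_mod N c, nonzerodivisor_mod (add_ideal N x) c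
    & nonzerodivisor_mod (add_ideal N f1) c].
  by split; [apply: (Nc 0%N) | apply: (Nc 1%N) | apply: (Nc 2%N)].
have Ms' f : f \in f2 :: s -> M f by move=> fs; apply: Ms; rewrite inE fs orbT.
have [t [tk Mt rt]] := IHk (f2 :: s) sk (add_ideal N f1) c Ms' (conj Nf2 Ns) Mc Nfc.
have Mt1 f : f \in f1 :: t -> M f by rewrite inE => /predU1P[-> //|/Mt].
have tk1 : size (f1 :: t) = k by rewrite /= tk /= -sk.
have [||t' [t'k Mt' rt']] := IHk (f1 :: t) tk1 (add_ideal N c) x Mt1 _ Mx.
- split; first exact: nonzerodivisor_swap.
  by rewrite add_idealC.
- exact: nonzerodivisor_swap.
exists (c :: t'); split.
- by rewrite /= t'k /= tk.
- by move=> f; rewrite inE => /predU1P[-> //|/Mt'].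
- by split=> //; rewrite add_idealC.
Qed.

Section Local.
Variable M : primeIdeal A.
Hypothesis M_local : forall x, ~ M x -> exists y, y * x = 1.

Lemma local_unit1 x b : M x -> exists y, y * (1 - b * x) = 1.
Proof.
move=> Mx; apply: M_local => M1; apply: (@prime_proper _ M).
by apply: ideal_DKl M1; apply/ideal_N/ideal_M.
Qed.

Lemma local_prime_le (P : primeIdeal A) : subideal P M.
Proof.
move=> x Px; apply: boolp.contrapT => /M_local[y yx].
by apply: (@prime_proper _ P); apply: ideal_unit yx Px _.
Qed.

(** If [z] is chosen maximal with annihilator containing [P], it stays nonzero
    modulo the first member [x] of the sequence, where it is annihilated by [P] and
    by [x], and [x] is not in [P]: an associated prime of [N + x] lies strictly above
    [P]. *)
Lemma regular_chain_above s N (P : primeIdeal A) :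
  (forall f, f \in s -> M f) -> regular_mod N s -> associated N P ->
  exists2 p : nat -> primeIdeal A, prime_chain p (size s) & p 0%N = P.
Proof.
elim: s N P => [|x s IHs] N P Ms; first by exists (fun=> P).
move=> [Nx rs] [z0 Nz0 PE].
have Mx : M x by apply: Ms; rewrite mem_head.
have Px : ~ P x by move=> /PE/Nx.
(* The element [z] is chosen with [N + z] maximal.  If [z = x * y] modulo [N], then
   [N + z] is strictly smaller than [N + y], because [x] lies in the maximal ideal. *)
have [J [_ [z [Nz Pz JE]] Jmax]] := noetherian_max noethA
  (F := fun J => exists z, [/\ ~ N z, forall y, P y -> N (y * z) & J = add_ideal N z])
  (ex_intro _ z0 (And3 Nz0 (fun y Py => proj1 (PE y) Py) erefl)).
have N'z : ~ add_ideal N x z.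
  move=> [a Na [y ze]].
  have Py t : P t -> N (t * y).
    move=> Pt; apply: Nx; have := Pz _ Pt; rewrite ze mulrDr mulrA [x * (_ * _)]mulrC.
    by move/(ideal_DKr (ideal_M _ Na)).
  have Ny : ~ N y by move=> Ny; apply: Nz; rewrite ze; apply: ideal_D => //; apply: ideal_Mr.
  have [b Nb [c ye]] : add_ideal N z y.
    rewrite -JE; apply: (Jmax (add_ideal N y)).
    - by exists y.
    - rewrite JE; apply: add_ideal_le; first exact: sub_add_ideal.
      rewrite ze; apply: ideal_D; first exact: sub_add_ideal.
      by apply: ideal_Mr; apply: mem_add_ideal.
    - exact: mem_add_ideal.
  have [v v1] := local_unit1 c Mx.
  apply: Ny; rewrite -[y]mul1r -v1 -mulrA; apply: ideal_M.
  have -> : (1 - c * x) * y = b + c * a by rewrite mulrBl mul1r {1}ye ze; ring.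
  by apply: ideal_D => //; apply: ideal_M.
have [Q aQ colonQ] := associated_above N'z.
have [|p pc p0] := IHs _ Q _ rs aQ.
  by move=> f fs; apply: Ms; rewrite inE fs orbT.
exists (fun i => if i is j.+1 then p j else P) => // -[|i] /=; last exact: pc.
move=> _; rewrite p0; split.
  by move=> y /Pz Ny; apply: colonQ; apply: sub_add_ideal.
move=> QP; apply/Px/QP/colonQ.
exact: ideal_Mr (mem_add_ideal N x).
Qed.

End Local.
End AssociatedPrimes.

(** * Quotients and localizations *)

Section ToQuotient.
Local Open Scope quotient_scope.
Variables (A : comPzRingType) (I : ideal A).

Definition to_quotient (a : A) : quotient_ring I := \pi a.

Lemma to_quotient_zmod_morphism : zmod_morphism to_quotient.
Proof.
move=> a b; apply: (addIr (to_quotient b)).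
by rewrite subrK /to_quotient quotient_addE subrK.
Qed.

Lemma to_quotient_monoid_morphism : monoid_morphism to_quotient.
Proof. by split=> // a b; apply/esym; apply: quotient_mulE. Qed.

HB.instance Definition _ :=
  GRing.isZmodMorphism.Build A (quotient_ring I) to_quotient to_quotient_zmod_morphism.
HB.instance Definition _ :=
  GRing.isMonoidMorphism.Build A (quotient_ring I) to_quotient
    to_quotient_monoid_morphism.

Lemma to_quotient_surj (x : quotient_ring I) : exists a, x = to_quotient a.
Proof. by exists (repr x); rewrite /to_quotient reprK. Qed.

Lemma to_quotient_eq0 a : to_quotient a = 0 <-> I a.
Proof.
rewrite -(rmorph0 to_quotient) /to_quotient.
split=> [/quotient_eqP/ideal_predP|Ia]; first by rewrite subr0.
by apply/quotient_eqP/ideal_predP; rewrite subr0.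
Qed.
End ToQuotient.

Section ToLocalization.
Local Open Scope quotient_scope.
Variables (A : comPzRingType) (P : primeIdeal A).

Let mk (a : A) (s : denominator P) : localization P := \pi_(localization P) (a, s).

Definition to_localization (a : A) : localization P := mk a (den_one P).

Lemma to_localization_zmod_morphism : zmod_morphism to_localization.
Proof.
move=> a b; rewrite /to_localization.
have -> : mk a (den_one P) - mk b (den_one P) =
  loc_add (mk a (den_one P)) (loc_opp (mk b (den_one P))) by [].
rewrite loc_oppE loc_addE; apply: loc_eq; exists 1; first exact: prime_proper.
by rewrite /= !(den_val1, den_valM); ring.
Qed.

Lemma to_localization_monoid_morphism : monoid_morphism to_localization.
Proof.
split=> // a b; rewrite /to_localization.
have -> : mk a (den_one P) * mk b (den_one P) =
  loc_mul (mk a (den_one P)) (mk b (den_one P)) by [].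
rewrite loc_mulE; apply: loc_eq; exists 1; first exact: prime_proper.
by rewrite /= !(den_val1, den_valM); ring.
Qed.

HB.instance Definition _ :=
  GRing.isZmodMorphism.Build A (localization P) to_localization
    to_localization_zmod_morphism.
HB.instance Definition _ :=
  GRing.isMonoidMorphism.Build A (localization P) to_localization
    to_localization_monoid_morphism.

Lemma to_localization_unit a : ~ P a -> exists t, t * to_localization a = 1.
Proof.
move=> Pa; exists (mk 1 (mk_denominator Pa)).
have -> : mk 1 (mk_denominator Pa) * to_localization a =
  loc_mul (mk 1 (mk_denominator Pa)) (mk a (den_one P)) by [].
rewrite loc_mulE; apply: loc_eq; exists 1; first exact: prime_proper.
by rewrite /= !(den_val1, den_valM) /den_val /=; ring.
Qed.

Lemma to_localization_frac (x : localization P) :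
  exists a s, ~ P s /\ x * to_localization s = to_localization a.
Proof.
exists (repr x).1, (den_val (repr x).2); split; first exact: denominatorP.
rewrite -{1}[x]reprK; case: (repr x) => a s.
have -> : mk a s * to_localization (den_val s) =
  loc_mul (mk a s) (mk (den_val s) (den_one P)) by [].
rewrite loc_mulE; apply: loc_eq; exists 1; first exact: prime_proper.
by rewrite /= !(den_val1, den_valM); ring.
Qed.

Lemma to_localization_eq0 a : to_localization a = 0 <-> exists2 u, ~ P u & u * a = 0.
Proof.
rewrite -(rmorph0 to_localization) /to_localization; split.
  move/loc_eqP/frac_eqbP => [u Pu]; rewrite /= den_val1 !mulr1 mulr0.
  by exists u.
by move=> [u Pu ua]; apply: loc_eq; exists u => //=; rewrite den_val1 !mulr1 mulr0.
Qed.
End ToLocalization.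

(** [L] is the localization at [M] of the quotient of [S] by [J].  The property is
    stated on [iota] alone, so that it can be transported along an automorphism of
    [S]. *)
Record localizes (S L : comPzRingType) (J : ideal S) (M : primeIdeal S)
    (iota : {rmorphism S -> L}) : Prop := Localizes {
  localizes_unit : forall s, ~ M s -> exists t, t * iota s = 1;
  localizes_frac : forall x, exists f s, ~ M s /\ x * iota s = iota f;
  localizes_ker : forall f, iota f = 0 <-> exists2 u, ~ M u & J (u * f)
}.

Section Contraction.
Variables (A B : comPzRingType) (phi : {rmorphism A -> B}).

Section ContractIdeal.
Variable N : ideal B.

Let mem0 : N (phi 0). Proof. by rewrite rmorph0; apply: ideal_0. Qed.

Let memD x y : N (phi x) -> N (phi y) -> N (phi (x + y)).
Proof. by rewrite rmorphD; apply: ideal_D. Qed.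

Let memM a x : N (phi x) -> N (phi (a * x)).
Proof. by rewrite rmorphM; apply: ideal_M. Qed.

Definition contract : ideal A := Ideal mem0 memD memM.
End ContractIdeal.

Section ContractPrime.
Variable P : primeIdeal B.

Let mem1 : ~ contract P 1. Proof. by rewrite /= rmorph1; apply: prime_proper. Qed.

Let memP x y : contract P (x * y) -> contract P x \/ contract P y.
Proof. by rewrite /= rmorphM; apply: prime_mul. Qed.

Definition contract_prime : primeIdeal A := PrimeIdeal mem1 memP.
End ContractPrime.

Lemma noetherian_image : noetherian A ->
  (forall x, exists f c d, phi f = c * x /\ x = d * phi f) -> noetherian B.
Proof.
move=> noethA frac N; have [s gen_s] := noethA (contract N).
exists (map phi s) => x; split.
  apply: ideal_gen_le => _ /mapP[f fs ->]; apply/(gen_s f).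
  exact: mem_ideal_gen.
have [f [c [d [fE xE]]]] := frac x; move=> Nx.
have : contract (ideal_seq (map phi s)) f.
  have /gen_s : contract N f by rewrite /= fE; apply: ideal_M.
  by apply: ideal_gen_le => g gs; apply: mem_ideal_gen; apply: map_f.
by move=> Nf; rewrite xE; apply: ideal_M.
Qed.
End Contraction.

Section LocalizationTheory.
Variables (S L : comPzRingType) (J : ideal S) (M : primeIdeal S).
Variable iota : {rmorphism S -> L}.
Hypothesis loc : localizes J M iota.
Hypothesis JM : subideal J M.
Implicit Types (N : ideal S) (Q : primeIdeal S).

Section ExtendIdeal.
Variable N : ideal S.

Let mem x := exists f s, [/\ N f, ~ M s & x * iota s = iota f].

Let mem0 : mem 0.
Proof.
exists 0, 1; split; [exact: ideal_0 | exact: prime_proper | by rewrite mul0r rmorph0].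
Qed.

Let memD x y : mem x -> mem y -> mem (x + y).
Proof.
move=> [f [s [Nf Ms xs]]] [g [t [Ng Mt yt]]].
exists (t * f + s * g), (s * t); split.
- by apply: ideal_D; apply: ideal_M.
- by move=> /(@prime_mul _ M)[].
- by rewrite rmorphD !rmorphM -xs -yt; ring.
Qed.

Let memM a x : mem x -> mem (a * x).
Proof.
move=> [f [s [Nf Ms xs]]]; have [h [r [Mr ar]]] := localizes_frac loc a.
exists (h * f), (r * s); split.
- exact: ideal_M.
- by move=> /(@prime_mul _ M)[].
- by rewrite !rmorphM -ar -xs; ring.
Qed.

Definition extend : ideal L := Ideal mem0 memD memM.
End ExtendIdeal.

Lemma localizes_mul_unit s x y : ~ M s -> x * iota s = y * iota s -> x = y.
Proof.
move=> /(localizes_unit loc)[t ts] e.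
by rewrite -[x]mulr1 -[y]mulr1 -ts [t * _]mulrC !mulrA e.
Qed.

Lemma mem_extend N f : subideal J N ->
  extend N (iota f) <-> exists2 u, ~ M u & N (u * f).
Proof.
move=> JN; split=> [[g [s [Ng Ms e]]]|[u Mu Nuf]]; last first.
  by exists (u * f), u; split=> //; rewrite rmorphM mulrC.
have : iota (f * s - g) = 0 by rewrite rmorphB rmorphM e subrr.
move/(localizes_ker loc) => [u Mu Ju]; exists (u * s).
  by move=> /(@prime_mul _ M)[].
have -> : u * s * f = u * (f * s - g) + u * g by ring.
by apply: ideal_D; [apply: JN | apply: ideal_M].
Qed.

Lemma extend_sub N f : N f -> extend N (iota f).
Proof. by exists f, 1; split=> //; [exact: prime_proper | rewrite rmorph1 mulr1]. Qed.

Lemma extend_zero : extend J = zero_ideal L.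
Proof.
apply: ideal_ext => x; split=> [[f [s [Jf Ms e]]]|->]; last exact: ideal_0.
apply: (localizes_mul_unit Ms); rewrite e mul0r; apply/(localizes_ker loc).
by exists 1; [apply: prime_proper | rewrite mul1r].
Qed.

Lemma extend_add_ideal N f : extend (add_ideal N f) = add_ideal (extend N) (iota f).
Proof.
apply: ideal_ext => x; split=> [[g [s [[a Na [b ->]] Ms e]]]|]; last first.
  apply: add_ideal_le => [y [g [s [Ng Ms e]]]|].
    by exists g, s; split=> //; apply: sub_add_ideal.
  by apply: extend_sub; apply: mem_add_ideal.
have [t ts] := localizes_unit loc Ms.
have -> : x = t * iota a + t * iota b * iota f.
  by rewrite -[x]mul1r -ts -mulrA [_ * x]mulrC e rmorphD rmorphM mulrDr mulrA.
apply: ideal_D; last by apply: ideal_M; apply: mem_add_ideal.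
by apply: sub_add_ideal; apply: ideal_M; apply: extend_sub.
Qed.

Lemma localizes_frac2 x : exists f c d, iota f = c * x /\ x = d * iota f.
Proof.
have [f [s [Ms e]]] := localizes_frac loc x; have [t ts] := localizes_unit loc Ms.
exists f, (iota s), t; split; first by rewrite -e mulrC.
by rewrite -e mulrCA ts mulr1.
Qed.

Lemma localizes_noetherian : noetherian S -> noetherian L.
Proof. by move=> nS; apply: (noetherian_image nS) => x; apply: localizes_frac2. Qed.

(** Every element of [L] is a unit times an element of [S], and membership in an
    extended ideal may be tested in [S] up to a factor outside [M]. *)
Lemma regular_mod_extend N s : subideal J N ->
  regular_mod (extend N) (map iota s) <-> locally_regular M N s.
Proof.
elim: s N => [|f s IHs] N JN //=.
have JNf : subideal J (add_ideal N f) by move=> x /JN; apply: sub_add_ideal.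
rewrite -extend_add_ideal IHs //; split=> -[rf rs]; split=> // x.
  by move=> Nfx; apply/mem_extend => //; apply: rf; rewrite -rmorphM; apply: extend_sub.
have [g [t [Mt e]]] := localizes_frac loc x; move=> Nfx.
have [v vt] := localizes_unit loc Mt.
have -> : x = v * iota g by rewrite -e mulrCA vt mulr1.
apply: ideal_M; apply/mem_extend => //.
have /(mem_extend _ JN)[u Mu] : extend N (iota (f * g)).
  by rewrite rmorphM -e mulrA; apply: ideal_Mr.
rewrite mulrCA => /rf[w Mw Nw]; exists (w * u); last by rewrite -mulrA.
by move=> /(@prime_mul _ M)[].
Qed.

Section ExtendPrime.
Variable Q : primeIdeal S.
Hypotheses (JQ : subideal J Q) (QM : subideal Q M).

Lemma mem_extend_prime f : extend Q (iota f) <-> Q f.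
Proof.
split=> [/(mem_extend _ JQ)[u Mu /(@prime_mul _ Q)[/QM|]] //|]; exact: extend_sub.
Qed.

Let mem1 : ~ extend Q 1.
Proof. by rewrite -(rmorph1 iota) mem_extend_prime; apply: prime_proper. Qed.

Let memP x y : extend Q (x * y) -> extend Q x \/ extend Q y.
Proof.
move=> Qxy.
have [f [c [d [fE xE]]]] := localizes_frac2 x.
have [g [c' [d' [gE yE]]]] := localizes_frac2 y.
have /mem_extend_prime/(@prime_mul _ Q) : extend Q (iota (f * g)).
  by rewrite rmorphM fE gE mulrACA; apply: ideal_M.
case=> [Qf|Qg]; [left; rewrite xE | right; rewrite yE];
  by apply: ideal_M; apply: extend_sub.
Qed.

Definition extend_prime : primeIdeal L := PrimeIdeal mem1 memP.
End ExtendPrime.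

Lemma extend_le N N' : subideal N N' -> subideal (extend N) (extend N').
Proof. by move=> NN' x [f [s [Nf Ms e]]]; exists f, s; split=> //; apply: NN'. Qed.

Definition local_prime : primeIdeal L := extend_prime JM (fun x Mx => Mx).

Lemma local_prime_unit x : ~ local_prime x -> exists y, y * x = 1.
Proof.
have [f [s [Ms e]]] := localizes_frac loc x => Mx.
have [|t tf] := localizes_unit loc (s := f).
  by move=> Mf; apply: Mx; exists f, s.
by exists (t * iota s); rewrite -mulrA [_ * x]mulrC e.
Qed.

Lemma local_prime_contract f : local_prime (iota f) <-> M f.
Proof. exact: mem_extend_prime. Qed.

Lemma local_prime_maximal : maximal_ideal local_prime.
Proof.
split=> [|N MN N1 x Nx]; first exact: prime_proper.
apply: boolp.contrapT => /local_prime_unit[y yx]; apply: N1.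
by rewrite -yx; apply: ideal_M.
Qed.

Lemma maximal_local_prime (N : ideal L) : maximal_ideal N -> N = local_prime.
Proof.
move=> [N1 Nmax].
have NM : subideal N local_prime.
  move=> x Nx; apply: boolp.contrapT => /local_prime_unit[y yx].
  by apply: N1; rewrite -yx; apply: ideal_M.
apply: ideal_ext => x; split; first exact: NM.
by apply: Nmax => //; apply: prime_proper.
Qed.

Lemma localizes_local : local_ring local_prime.
Proof.
by split=> [|N /maximal_local_prime -> //]; apply: local_prime_maximal.
Qed.

Lemma contract_strict (p q : primeIdeal L) : strict_subideal p q ->
  strict_subideal (contract_prime iota p) (contract_prime iota q).
Proof.
move=> [pq qp]; split=> [f|le]; first exact: pq.
apply: qp => x qx; have [f [c [d [fE xE]]]] := localizes_frac2 x.
by rewrite xE; apply: ideal_M; apply: le; rewrite /= fE; apply: ideal_M.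
Qed.

Lemma contract_ge (p : primeIdeal L) : subideal J (contract_prime iota p).
Proof.
move=> f Jf /=; have -> : iota f = 0; last exact: ideal_0.
by apply/(localizes_ker loc); exists 1; [apply: prime_proper | rewrite mul1r].
Qed.

Lemma contract_le (p : primeIdeal L) : subideal (contract_prime iota p) M.
Proof.
move=> f pf; apply/local_prime_contract; move: pf.
exact: (local_prime_le local_prime_unit).
Qed.

Lemma extend_chain (p : nat -> primeIdeal S) k : prime_chain p k ->
  subideal J (p 0%N) -> subideal (p k) M ->
  exists q : nat -> primeIdeal L, prime_chain q k.
Proof.
move=> pc Jp pM.
have Jpi i : (i <= k)%N -> subideal J (p i).
  by move=> ik x /Jp; apply: (prime_chain_mono pc).
have piM i : (i <= k)%N -> subideal (p i) M.
  by move=> ik x px; apply: pM; apply: (prime_chain_mono pc) px.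
have [|q qE] := boolp.choice (P := fun i (q : primeIdeal L) => (i <= k)%N ->
    same_ideal q (extend (p i))).
  move=> i; have [ik|ik] := boolp.EM (i <= k)%N; last by exists local_prime.
  by exists (extend_prime (Jpi i ik) (piM i ik)).
exists q => i ik; have [le nle] := pc i ik.
split=> [x /(qE i (ltnW ik)) px|qle]; first by apply/(qE _ ik); apply: extend_le px.
apply: nle => f pf; apply/(mem_extend_prime (Jpi i (ltnW ik)) (piM i (ltnW ik))).
by apply/(qE i (ltnW ik))/qle/(qE _ ik); apply: extend_sub.
Qed.

End LocalizationTheory.

Section QuotientLocalization.
Variables (S : comPzRingType) (J : ideal S) (M : primeIdeal (quotient_ring J)).

Lemma quotient_localizes :
  localizes J (contract_prime (@to_quotient S J) M)
    ((@to_localization _ M) \o (@to_quotient S J) : {rmorphism S -> localization M}).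
Proof.
split=> [s Ms|x|f] /=.
- exact: to_localization_unit.
- have [a [s [Ms e]]] := to_localization_frac x.
  have [f aE] := to_quotient_surj a; have [t sE] := to_quotient_surj s.
  by exists f, t; rewrite -aE -sE.
- split=> [/to_localization_eq0[a Ma e]|[u Mu Ju]].
    have [u aE] := to_quotient_surj a; exists u; first by rewrite aE in Ma.
    by apply/to_quotient_eq0; rewrite rmorphM; move: e; rewrite aE.
  by apply/to_localization_eq0; exists (to_quotient J u); rewrite // -rmorphM;
    apply/to_quotient_eq0.
Qed.

Lemma quotient_contract_ge : subideal J (contract_prime (@to_quotient S J) M).
Proof.
move=> f Jf /=; have -> : to_quotient J f = 0 by apply/to_quotient_eq0.
exact: ideal_0.
Qed.
End QuotientLocalization.

Section QuotientPrime.
Variables (S : comPzRingType) (J : ideal S) (Q : primeIdeal S).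
Hypothesis JQ : subideal J Q.

Let memE a b : to_quotient J a = to_quotient J b -> Q a -> Q b.
Proof.
move=> e Qa; have /to_quotient_eq0/JQ : to_quotient J (a - b) = 0 by rewrite rmorphB /= e subrr.
by move/(ideal_B Qa); rewrite opprB addrC subrK.
Qed.

Let mem x := exists2 a, x = to_quotient J a & Q a.

Let mem0 : mem 0. Proof. by exists 0; [rewrite rmorph0 | apply: ideal_0]. Qed.

Let memD x y : mem x -> mem y -> mem (x + y).
Proof.
by move=> [a -> Qa] [b -> Qb]; exists (a + b); [rewrite rmorphD | apply: ideal_D].
Qed.

Let memM c x : mem x -> mem (c * x).
Proof.
have [b ->] := to_quotient_surj c.
by move=> [a -> Qa]; exists (b * a); [rewrite rmorphM | apply: ideal_M].
Qed.

Let mem1 : ~ Ideal mem0 memD memM 1.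
Proof.
by move=> [a e Qa]; apply: (@prime_proper _ Q); apply: memE Qa; rewrite -e rmorph1.
Qed.

Let memP x y : Ideal mem0 memD memM (x * y) ->
  Ideal mem0 memD memM x \/ Ideal mem0 memD memM y.
Proof.
have [a ->] := to_quotient_surj x; have [b ->] := to_quotient_surj y.
rewrite -rmorphM => -[c e Qc].
by have /(@prime_mul _ Q)[Qa|Qb] := memE (esym e) Qc; [left; exists a | right; exists b].
Qed.

Definition quotient_prime : primeIdeal (quotient_ring J) := PrimeIdeal mem1 memP.

Lemma quotient_primeE f : quotient_prime (to_quotient J f) <-> Q f.
Proof. by split=> [[a e]|Qf]; [apply: memE | exists f]. Qed.
End QuotientPrime.

(** * The Hilbert basis theorem *)

Section Dickson.

Lemma nondecreasing_subsequence (u : nat -> nat) :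
  exists g : nat -> nat, forall i, (g i < g i.+1)%N /\ (u (g i) <= u (g i.+1))%N.
Proof.
have [|next nextP] := boolp.choice (P := fun N m => (N <= m)%N /\
    forall k, (N <= k)%N -> (u m <= u k)%N).
  move=> N; have exv : exists v, boolp.asbool (exists2 m, (N <= m)%N & u m = v).
    by exists (u N); apply/boolp.asboolP; exists N.
  have [v /boolp.asboolP[m Nm um] vmin] := ex_minnP exv.
  exists m; split=> // k Nk; rewrite um; apply: vmin.
  by apply/boolp.asboolP; exists k.
pose g i := iter i (fun m => next m.+1) (next 0%N).
exists g => i; have [lt_g _] := nextP (g i).+1; split=> //.
case: i {lt_g} => [|i]; first by apply: (nextP 0%N).2.
have [lt1 _] := nextP (g i).+1; have [lt2 _] := nextP (g i.+1).+1.
have [_ le1] := nextP (g i).+1.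
by apply: le1; apply: ltnW; apply: leq_ltn_trans lt1 _; exact: lt2.
Qed.

(** One passes, variable after variable, to a subsequence along which the exponent
    is nondecreasing. *)
Lemma dickson n (f : nat -> 'X_{1..n}) :
  exists i j, (i < j)%N /\ (f i <= f j)%MM.
Proof.
suff [g gP] : exists g : nat -> nat, forall i, (g i < g i.+1)%N /\
    forall a, a \in enum 'I_n -> (f (g i) a <= f (g i.+1) a)%N.
  have [g01 f01] := gP 0%N; exists (g 0%N), (g 1%N); split=> //.
  by apply/mnm_lepP => a; apply: f01; rewrite mem_enum.
elim: (enum _) => [|a s [g gP]]; first by exists id => i; split.
have [h hP] := nondecreasing_subsequence (fun i => f (g i) a).
have g_lt i j : (i < j)%N -> (g i < g j)%N.
  by apply: (homo_ltn ltn_trans) => k; case: (gP k).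
have g_le b i j : b \in s -> (i <= j)%N -> (f (g i) b <= f (g j) b)%N.
  move=> bs; apply: (homo_leq (f := fun i => f (g i) b) leqnn leq_trans) => k.
  by apply: (gP k).2.
exists (g \o h) => i; have [lt_h le_h] := hP i; split; first exact: g_lt.
move=> b; rewrite inE => /predU1P[-> //|bs]; apply: g_le => //; exact: ltnW.
Qed.

End Dickson.

Section HilbertBasis.
Variables (K : fieldType) (n : nat).
Implicit Types (f g : {mpoly K[n]}) (s : seq {mpoly K[n]}).

Lemma mlead_reduce f g : f != 0 -> g != 0 -> (mlead f <= mlead g)%MM ->
  exists c, g - c * f = 0 \/ (mlead (g - c * f)%R < mlead g)%O.
Proof.
move=> f0 g0 le_fg.
have fc0 : mleadc f != 0 by rewrite mleadc_eq0.
have gc0 : mleadc g != 0 by rewrite mleadc_eq0.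
have c0 : mleadc g / mleadc f != 0 by rewrite mulf_neq0 ?invr_eq0.
pose c : {mpoly K[n]} := (mleadc g / mleadc f) *: 'X_[mlead g - mlead f].
have lead_c : mlead c = (mlead g - mlead f)%MM by rewrite mleadZ // mleadXm.
have lead_cf : mlead (c * f) = mlead g.
  by rewrite mleadM // ?lead_c ?submK // -mleadc_eq0 lead_c mcoeffZ mcoeffX eqxx mulr1.
have [e|h0] := eqVneq (g - c * f) 0; [by exists c; left | exists c; right].
have hg : (g - c * f)@_(mlead g) = 0.
  have <- : (mlead c + mlead f)%MM = mlead g by rewrite lead_c submK.
  rewrite mcoeffB mleadcM lead_c /c mcoeffZ mcoeffX eqxx mulr1 submK //.
  by rewrite divfK // subrr.
have := mleadB_le g (c * f); rewrite lead_cf joinxx le_eqVlt => /predU1P[e|//].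
by move: h0; rewrite -mleadc_eq0 e hg eqxx.
Qed.

(** If [I] is not finitely generated, choose successively elements outside the
    ideal of the previous ones, with the smallest possible leading monomial.  By
    Dickson's lemma one leading monomial is a multiple of an earlier one, and the
    reduction contradicts minimality. *)
Theorem hilbert_basis : noetherian {mpoly K[n]}.
Proof.
move=> I; apply: boolp.contrapT => noI.
have step s : exists f, (forall x, x \in s -> I x) ->
   [/\ I f, ~ ideal_seq s f
     & forall g, I g -> (mlead g < mlead f)%O -> ideal_seq s g].
  have [sI|] := boolp.EM (forall x, x \in s -> I x); last by exists 0.
  have [f [If sf]] : exists f, I f /\ ~ ideal_seq s f.
    apply: boolp.contrapT => nof; apply: noI; exists s => x.
    split; first exact: ideal_gen_le.
    by move=> Ix; apply: boolp.contrapT => sx; apply: nof; exists x.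
  apply: boolp.contrapT => nomin.
  have [m mE] : exists m, m = mlead f by exists (mlead f).
  elim/(well_founded_ind (@ltom_wf n)): m f mE If sf => m IHm f mE If sf.
  apply: nomin; exists f => _; split=> // g Ig gf; apply: boolp.contrapT => sg.
  by apply: (IHm (mlead g)) (erefl _) Ig sg; rewrite mE.
have [F FP] := boolp.choice step.
pose S k := iter k (fun s => F s :: s) [::].
have SI k : forall x, x \in S k -> I x.
  elim: k => [|k IHk] x //=; rewrite inE => /predU1P[->|/IHk //].
  by have [] := FP _ IHk.
have FS i j : (i < j)%N -> F (S i) \in S j.
  elim: j => // j IHj; rewrite ltnS leq_eqVlt => /predU1P[->|/IHj Fj] /=.
    by rewrite mem_head.
  by rewrite inE Fj orbT.
have F0 k : F (S k) != 0.
  apply/eqP => Fk; have [_ + _] := FP _ (SI k); apply; rewrite Fk.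
  exact: ideal_0.
have [i [j [ij le_ij]]] := dickson (fun k => mlead (F (S k))).
have [IF SF Fmin] := FP _ (SI j).
have SFi : ideal_seq (S j) (F (S i)) by apply: mem_ideal_gen; apply: FS.
have [c cP] := mlead_reduce (F0 i) (F0 j) le_ij.
apply: SF; rewrite -(subrK (c * F (S i)) (F (S j))).
apply: ideal_D; last exact: ideal_M.
case: cP => [->|lt_c]; first exact: ideal_0.
apply: Fmin => //; apply: ideal_B => //; apply: ideal_M; apply: (SI j); exact: FS.
Qed.

End HilbertBasis.

(** * Polynomials with restricted support *)

Section Support.
Variables (K : fieldType) (n : nat).
Implicit Types (f g : {mpoly K[n]}) (m : 'X_{1..n}) (G H : 'X_{1..n} -> Prop) (V W : {set 'I_n}).

Definition supported G f : Prop := forall m, m \in msupp f -> G m.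

Lemma supported0 G : supported G 0.
Proof. by move=> m; rewrite msupp0. Qed.

Lemma supportedD G f g : supported G f -> supported G g -> supported G (f + g).
Proof. by move=> Gf Gg m /msuppD_le; rewrite mem_cat => /orP[/Gf|/Gg]. Qed.

Lemma supportedZ G c f : supported G f -> supported G (c *: f).
Proof. by move=> Gf m /msuppZ_le/Gf. Qed.

Lemma supportedN G f : supported G f -> supported G (- f).
Proof. by rewrite -scaleN1r; apply: supportedZ. Qed.

Lemma supportedX G m : G m -> supported G 'X_[m].
Proof. by move=> Gm m' /mem_msuppXP <-. Qed.

Lemma supported_sum G (T : Type) (r : seq T) (P : pred T) (F : T -> {mpoly K[n]}) :
  (forall i, P i -> supported G (F i)) -> supported G (\sum_(i <- r | P i) F i).
Proof. by move=> GF; elim/big_ind: _ => //; [apply: supported0 | apply: supportedD]. Qed.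

Lemma supportedM G1 G2 G f g : (forall m1 m2, G1 m1 -> G2 m2 -> G (m1 + m2)%MM) ->
  supported G1 f -> supported G2 g -> supported G (f * g).
Proof.
by move=> G12 Gf Gg m /msuppM_le/allpairsP[[m1 m2] [/Gf G1m /Gg G2m ->]]; apply: G12.
Qed.

Lemma supported_neq0 G f m : supported G f -> f@_m != 0 -> G m.
Proof. by move=> Gf fm; apply: Gf; rewrite mcoeff_msupp. Qed.

Lemma supportedS G H f : (forall m, G m -> H m) -> supported G f -> supported H f.
Proof. by move=> GH Gf m /Gf/GH. Qed.

Definition mono_in (V : {set 'I_n}) m : Prop := forall a, m a != 0%N -> a \in V.

Lemma mono_inD V m1 m2 : mono_in V m1 -> mono_in V m2 -> mono_in V (m1 + m2)%MM.
Proof.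
move=> V1 V2 a; rewrite mnmDE addn_eq0 negb_and => /orP[]; [exact: V1 | exact: V2].
Qed.

Definition poly_in V f : Prop := supported (mono_in V) f.

Lemma poly_inC V c : poly_in V c%:MP.
Proof. by move=> m; rewrite msuppC; case: eqP => // _; rewrite inE => /eqP-> a; rewrite mnm0E. Qed.

Lemma poly_in0 V : poly_in V 0. Proof. exact: supported0. Qed.

Lemma poly_in1 V : poly_in V 1. Proof. by rewrite -mpolyC1; apply: poly_inC. Qed.

Lemma poly_inX V a : a \in V -> poly_in V 'X_a.
Proof.
by move=> aV; apply: supportedX => b; rewrite mnm1E; have [<-|] := eqVneq a b.
Qed.

Lemma poly_inD V f g : poly_in V f -> poly_in V g -> poly_in V (f + g).
Proof. exact: supportedD. Qed.

Lemma poly_inN V f : poly_in V f -> poly_in V (- f).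
Proof. exact: supportedN. Qed.

Lemma poly_inM V f g : poly_in V f -> poly_in V g -> poly_in V (f * g).
Proof. exact: supportedM (@mono_inD V). Qed.

Lemma poly_in_exp V f k : poly_in V f -> poly_in V (f ^+ k).
Proof.
move=> Vf; elim: k => [|k IHk]; first exact: poly_in1.
by rewrite exprS; apply: poly_inM.
Qed.

Lemma poly_in_sum V (T : Type) (r : seq T) (P : pred T) (F : T -> {mpoly K[n]}) :
  (forall i, P i -> poly_in V (F i)) -> poly_in V (\sum_(i <- r | P i) F i).
Proof. exact: supported_sum. Qed.

Lemma poly_in_prod V (T : Type) (r : seq T) (P : pred T) (F : T -> {mpoly K[n]}) :
  (forall i, P i -> poly_in V (F i)) -> poly_in V (\prod_(i <- r | P i) F i).
Proof.
by move=> VF; elim/big_ind: _ => //; [apply: poly_in1 | apply: poly_inM].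
Qed.

Lemma poly_inS V W f : V \subset W -> poly_in V f -> poly_in W f.
Proof. by move=> /subsetP VW; apply: supportedS => m Vm a /Vm/VW. Qed.

Lemma poly_in_setT f : poly_in setT f.
Proof. by move=> m _ a _; rewrite inE. Qed.

Lemma poly_in_ind V (Q : {mpoly K[n]} -> Prop) :
  (forall c, Q c%:MP) -> (forall a, a \in V -> Q 'X_a) ->
  (forall f g, Q f -> Q g -> Q (f + g)) -> (forall f g, Q f -> Q g -> Q (f * g)) ->
  forall f, poly_in V f -> Q f.
Proof.
move=> QC QX QD QM f Vf.
have Q0 : Q 0 by rewrite -mpolyC0; apply: QC.
have Q1 : Q 1 by rewrite -mpolyC1; apply: QC.
rewrite [f]mpolyE big_seq; apply: (big_ind Q Q0 QD) => m /Vf Vm.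
rewrite -mul_mpolyC; apply: (QM) => //; rewrite mpolyXE_id.
apply: (big_ind Q Q1 QM) => a _.
have [->|/Vm/QX Qa] := eqVneq (m a) 0%N; first by rewrite expr0.
by elim: (m a) => [|k IHk]; rewrite ?expr0 // exprS; apply: (QM).
Qed.

Lemma mpoly_ind_ring (Q : {mpoly K[n]} -> Prop) :
  (forall c, Q c%:MP) -> (forall a, Q 'X_a) ->
  (forall f g, Q f -> Q g -> Q (f + g)) -> (forall f g, Q f -> Q g -> Q (f * g)) ->
  forall f, Q f.
Proof.
move=> QC QX QD QM f; apply: (@poly_in_ind setT) => //; exact: poly_in_setT.
Qed.

(** The variables of [V] are algebraically independent modulo [I]. *)
Definition independent_mod (I : {mpoly K[n]} -> Prop) V : Prop :=
  forall f, poly_in V f -> I f -> f = 0.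

End Support.
Arguments poly_in_setT {K n} f.

Lemma mulr_sub_mul (A : comPzRingType) (a b c d : A) :
  a * c - b * d = c * (a - b) + b * (c - d).
Proof. by ring. Qed.

Section Evaluation.
Variables (K : fieldType) (N n : nat).
Implicit Types (y : 'I_N -> {mpoly K[n]}) (Q : {mpoly K[N]}).

Definition mpoly_eval y : {mpoly K[N]} -> {mpoly K[n]} := mmap (@mpolyC n K) y.

HB.instance Definition _ y := GRing.RMorphism.on (mpoly_eval y).

Lemma mpoly_evalD y P Q : mpoly_eval y (P + Q) = mpoly_eval y P + mpoly_eval y Q.
Proof. exact: rmorphD. Qed.

Lemma mpoly_evalB y P Q : mpoly_eval y (P - Q) = mpoly_eval y P - mpoly_eval y Q.
Proof. exact: rmorphB. Qed.

Lemma mpoly_evalM y P Q : mpoly_eval y (P * Q) = mpoly_eval y P * mpoly_eval y Q.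
Proof. exact: rmorphM. Qed.

Lemma mpoly_evalC y c : mpoly_eval y c%:MP = c%:MP.
Proof. exact: mmapC. Qed.

Lemma mpoly_evalX y i : mpoly_eval y 'X_i = y i.
Proof. by rewrite /mpoly_eval mmapX mmap1U. Qed.

Lemma mpoly_evalXm y m : mpoly_eval y 'X_[m] = \prod_i y i ^+ m i.
Proof. by rewrite /mpoly_eval mmapX. Qed.

Lemma mpoly_evalZ y c Q : mpoly_eval y (c *: Q) = c *: mpoly_eval y Q.
Proof. by rewrite -!mul_mpolyC mpoly_evalM mpoly_evalC. Qed.

Lemma poly_in_eval y (V : {set 'I_N}) (W : {set 'I_n}) Q : poly_in V Q -> (forall i, i \in V -> poly_in W (y i)) ->
  poly_in W (mpoly_eval y Q).
Proof.
move=> VQ Vy; move: Q VQ; apply: poly_in_ind => [c|i /Vy|P1 P2 W1 W2|P1 P2 W1 W2].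
- by rewrite mpoly_evalC; apply: poly_inC.
- by rewrite mpoly_evalX.
- by rewrite mpoly_evalD; apply: poly_inD.
- by rewrite mpoly_evalM; apply: poly_inM.
Qed.

Lemma mpoly_eval_mod (I : ideal {mpoly K[n]}) y z Q :
  (forall i, I (y i - z i)) -> I (mpoly_eval y Q - mpoly_eval z Q).
Proof.
move=> Iyz; move: Q; apply: mpoly_ind_ring => [c|i|P1 P2 I1 I2|P1 P2 I1 I2].
- by rewrite !mpoly_evalC subrr; apply: ideal_0.
- by rewrite !mpoly_evalX.
- by rewrite !mpoly_evalD opprD addrACA; apply: ideal_D.
- rewrite !mpoly_evalM mulr_sub_mul.
  by apply: ideal_D; apply: ideal_M.
Qed.

End Evaluation.

Lemma mpoly_eval_comp (K : fieldType) (N n p : nat) (y : 'I_N -> {mpoly K[n]})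
    (z : 'I_n -> {mpoly K[p]}) (Q : {mpoly K[N]}) :
  mpoly_eval z (mpoly_eval y Q) = mpoly_eval (fun i => mpoly_eval z (y i)) Q.
Proof.
move: Q; apply: mpoly_ind_ring => [c|i|P1 P2 e1 e2|P1 P2 e1 e2].
- by rewrite !mpoly_evalC.
- by rewrite !mpoly_evalX.
- by rewrite !mpoly_evalD e1 e2.
- by rewrite !mpoly_evalM e1 e2.
Qed.

Lemma mpoly_eval_id (K : fieldType) (n : nat) (V : {set 'I_n}) (y : 'I_n -> {mpoly K[n]}) Q :
  poly_in V Q -> (forall i, i \in V -> y i = 'X_i) -> mpoly_eval y Q = Q.
Proof.
move=> VQ yX; move: Q VQ; apply: poly_in_ind => [c|i /yX|P1 P2 e1 e2|P1 P2 e1 e2].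
- exact: mpoly_evalC.
- by rewrite mpoly_evalX.
- by rewrite mpoly_evalD e1 e2.
- by rewrite mpoly_evalM e1 e2.
Qed.

Section Univariate.
Variables (K : fieldType) (n : nat) (w : 'I_n).
Implicit Types (f g : {mpoly K[n]}) (V : {set 'I_n}).

(** A polynomial seen as a univariate polynomial in the variable [w], with
    coefficients kept in the same ring. *)
Definition univariate : {mpoly K[n]} -> {poly {mpoly K[n]}} :=
  mmap (polyC \o @mpolyC n K) (fun a => if a == w then 'X else ('X_a)%:P).

HB.instance Definition _ := GRing.RMorphism.on univariate.

Lemma univariateD f g : univariate (f + g) = univariate f + univariate g.
Proof. exact: rmorphD. Qed.

Lemma univariateM f g : univariate (f * g) = univariate f * univariate g.
Proof. exact: rmorphM. Qed.

Lemma univariateC c : univariate c%:MP = (c%:MP)%:P.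
Proof. exact: mmapC. Qed.

Lemma univariateX a : univariate 'X_a = if a == w then 'X else ('X_a)%:P.
Proof. by rewrite /univariate mmapX mmap1U. Qed.

Lemma univariate_free V f : w \notin V -> poly_in V f -> univariate f = f%:P.
Proof.
move=> wV Vf; move: f Vf; apply: poly_in_ind => [c|a aV|f1 f2 e1 e2|f1 f2 e1 e2].
- exact: univariateC.
- by rewrite univariateX; case: eqP => // aw; move: wV; rewrite -aw aV.
- by rewrite univariateD e1 e2 polyCD.
- by rewrite univariateM e1 e2 polyCM.
Qed.

Lemma univariateK f : (univariate f).['X_w] = f.
Proof.
move: f; apply: mpoly_ind_ring => [c|a|f1 f2 e1 e2|f1 f2 e1 e2].
- by rewrite univariateC hornerC.
- by rewrite univariateX; case: eqP => [->|_]; rewrite ?hornerX ?hornerC.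
- by rewrite univariateD hornerD; congr (_ + _).
- by rewrite univariateM hornerM; congr (_ * _).
Qed.

Lemma univariate_eq0 f : univariate f = 0 -> f = 0.
Proof. by move=> e; rewrite -(univariateK f) e horner0. Qed.

Lemma poly_in_univariate V f r : poly_in V f -> poly_in (V :\ w) (univariate f)`_r.
Proof.
move=> Vf; move: f Vf r; apply: poly_in_ind => [c|a aV|f1 f2 e1 e2|f1 f2 e1 e2] r.
- by rewrite univariateC coefC; case: ifP => _; [apply: poly_inC | apply: poly_in0].
- rewrite univariateX; case: eqP => [_|/eqP aw].
    by rewrite coefX; case: eqP => _; [apply: poly_in1 | apply: poly_in0].
  rewrite coefC; case: ifP => _; last exact: poly_in0.
  by apply: poly_inX; rewrite !inE aw.
- by rewrite univariateD coefD; exact (poly_inD (e1 r) (e2 r)).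
- rewrite univariateM coefM; apply: poly_in_sum => i _.
  exact (poly_inM (e1 i) (e2 (r - i)%N)).
Qed.

End Univariate.

(** * Algebraic dependence and lengths of chains *)

Lemma linear_relation (K : fieldType) (n : nat) (T : finType)
    (f : T -> {mpoly K[n]}) (E : seq 'X_{1..n}) :
  (forall j, supported (fun m => m \in E) (f j)) -> (size E < #|T|)%N ->
  exists c : T -> K, (exists j, c j != 0) /\ \sum_j c j *: f j = 0.
Proof.
move=> fE ltET.
pose A := \matrix_(i < #|T|, l < size E) (f (enum_val i))@_(nth 0%MM E l).
have kerA : kermx A != 0.
  by rewrite -mxrank_eq0 mxrank_ker subn_eq0 -ltnNge (leq_ltn_trans (rank_leq_col A)).
have /rowV0Pn[v /sub_kermxP vA v0] := kerA.
exists (fun j => v 0 (enum_rank j)); split.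
  have [i vi] : exists i, v 0 i != 0.
    apply/existsP; rewrite -negb_forall; apply: contra v0 => /forallP v0.
    by apply/eqP/rowP => i; rewrite mxE; apply/eqP.
  by exists (enum_val i); rewrite enum_valK.
apply/mpolyP => m; rewrite mcoeff0 raddf_sum /=.
have [mE|mE] := boolP (m \in E); last first.
  rewrite big1 // => j _; rewrite mcoeffZ memN_msupp_eq0 ?mulr0 //.
  by apply: contra mE => /fE.
have lE : (index m E < size E)%N by rewrite index_mem.
have /matrixP/(_ 0 (Ordinal lE)) := vA; rewrite !mxE => vAE; rewrite -[RHS]vAE.
rewrite (reindex (@enum_val T predT)) /=; last by apply: onW_bij; apply: enum_val_bij.
by apply: eq_bigr => i _; rewrite mcoeffZ mxE /= enum_valK nth_index.
Qed.

(** Counts of monomials in [v] and in [N] variables are compared by this growth. *)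
Lemma polynomial_growth c d v N : (v < N)%N ->
  exists s, (d * (c * s).+1 ^ v < s.+1 ^ N)%N.
Proof.
move=> ltvN; pose s := (d * c.+1 ^ v)%N; exists s.
apply: (@leq_ltn_trans (d * (c.+1 * s.+1) ^ v)).
  rewrite leq_mul2l; case: (posnP v) => [->|v0]; first by rewrite leqnn orbT.
  rewrite leq_exp2r //; apply/orP; right.
  have le1 t : ((c * t).+1 <= c.+1 * t.+1)%N by nia.
  exact: le1.
apply: (@leq_ltn_trans (s * s.+1 ^ v)); first by rewrite expnMn mulnA.
apply: (@leq_trans (s.+1 ^ v.+1)); last by rewrite leq_pexp2l.
by rewrite expnS ltn_mul2r expn_gt0 /=.
Qed.

Section Dependence.
Variables (K : fieldType) (n : nat).
Implicit Types (f g : {mpoly K[n]}) (V W : {set 'I_n}).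

Definition box V b : seq 'X_{1..n} :=
  [seq [multinom (e i : nat) | i < n] | e : {ffun 'I_n -> 'I_b.+1} in
     pffun_on ord0 (mem V) predT].

Lemma size_box V b : size (box V b) = (b.+1 ^ #|V|)%N.
Proof. by rewrite size_image card_pffun_on card_ord. Qed.

Lemma mem_box V b m : mono_in V m -> (forall a, (m a <= b)%N) -> m \in box V b.
Proof.
move=> Vm mb; apply/imageP; exists [ffun a => inord (m a) : 'I_b.+1].
  apply/pffun_onP; split=> //; apply/subsetP => a; rewrite !inE ffunE => ma.
  apply: Vm; apply: contra ma => /eqP->; apply/eqP/val_inj.
  by rewrite /= inordK.
by apply/mnmP => a; rewrite mnmE ffunE inordK // ltnS.
Qed.

Lemma supported_deg_prod (T : Type) (r : seq T) (F : T -> {mpoly K[n]}) (d : T -> nat) :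
  (forall i, supported (fun m => mdeg m <= d i)%N (F i)) ->
  supported (fun m => mdeg m <= \sum_(i <- r) d i)%N (\prod_(i <- r) F i).
Proof.
move=> dF; elim: r => [|i r IHr].
  by rewrite !big_nil -mpolyX0; apply: supportedX; rewrite mdeg0.
rewrite !big_cons; apply: supportedM (dF i) IHr => m1 m2 l1 l2.
by rewrite mdegD leq_add.
Qed.

Lemma supported_deg_exp f d k : supported (fun m => mdeg m <= d)%N f ->
  supported (fun m => mdeg m <= k * d)%N (f ^+ k).
Proof.
move=> df; elim: k => [|k IHk].
  by rewrite expr0 -mpolyX0; apply: supportedX; rewrite mdeg0.
rewrite exprS mulSn; apply: supportedM df IHk => m1 m2 l1 l2.
by rewrite mdegD leq_add.
Qed.

(** The products of the [g i] with bounded exponents outnumber the monomials in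
    which they can be expanded. *)
Lemma algebraic_dependence V N (g : 'I_N -> {mpoly K[n]}) :
  (#|V| < N)%N -> (forall i, poly_in V (g i)) ->
  exists2 Q : {mpoly K[N]}, Q != 0 & mpoly_eval g Q = 0.
Proof.
move=> ltVN Vg; pose D := (\max_i msize (g i))%N.
have gD i : supported (fun m => mdeg m <= D)%N (g i).
  move=> m /msize_mdeg_lt/ltnW/leq_trans; apply.
  exact: (leq_bigmax (F := fun i => msize (g i))).
(* Products of the [g i] with exponents at most [s] have degree at most
   [N * D * s]: there are [s.+1 ^ N] of them, and their monomials lie in a box with
   [(N * D * s).+1 ^ #|V|] elements. *)
have [s lts] := polynomial_growth (N * D) 1 ltVN.
pose mon (e : {ffun 'I_N -> 'I_s.+1}) := [multinom (e i : nat) | i < N].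
pose F e := mpoly_eval g 'X_[mon e].
have FE e : supported (fun m => m \in box V (N * D * s)) (F e).
  rewrite /F mpoly_evalXm.
  have VF : poly_in V (\prod_i g i ^+ mon e i).
    by apply: poly_in_prod => i _; apply: poly_in_exp.
  have dF := @supported_deg_prod _ (index_enum _) (fun i => g i ^+ mon e i) _
    (fun i => @supported_deg_exp _ D (mon e i) (gD i)).
  move=> m mF; have Vm := VF m mF; have dm := dF m mF.
  apply: mem_box => // a; apply: (@leq_trans (mdeg m)).
    by rewrite mdegE (bigD1 a) //= leq_addr.
  apply: (leq_trans dm); apply: (@leq_trans (\sum_(i < N) s * D)).
    by apply: leq_sum => i _; rewrite leq_mul2r mnmE -ltnS ltn_ord orbT.
  by rewrite sum_nat_const card_ord; lia.
have [|c [[e0 ce0] sumc]] := linear_relation FE.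
  by rewrite size_box card_ffun !card_ord; move: lts; rewrite mul1n.
exists (\sum_e c e *: 'X_[mon e]).
  apply: contra ce0 => /eqP/mpolyP/(_ (mon e0)).
  rewrite mcoeff0 raddf_sum (bigD1 e0) //= mcoeffZ mcoeffX eqxx mulr1.
  rewrite big1 ?addr0 => [->//|e ne]; rewrite mcoeffZ mcoeffX.
  case: eqP => [/mnmP eq_e|]; last by rewrite mulr0.
  case/eqP: ne; apply/ffunP => i; apply/val_inj.
  by have := eq_e i; rewrite !mnmE.
rewrite -[RHS]sumc.
have -> : mpoly_eval g (\sum_e c e *: 'X_[mon e]) =
    \sum_e mpoly_eval g (c e *: 'X_[mon e]) by exact: rmorph_sum.
by apply: eq_bigr => e _; rewrite mpoly_evalZ.
Qed.

End Dependence.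

Lemma horner_low_term (A : comNzRingType) (q : {poly A}) (x : A) : q != 0 ->
  exists r t, q`_r != 0 /\ q.[x] = x ^+ r * (q`_r + x * t).
Proof.
elim/poly_ind: q => [|q c IHq]; first by rewrite eqxx.
have [->|c0] := eqVneq c 0.
  rewrite addr0 => qX0; have [|r [t [qr qE]]] := IHq.
    by apply: contra qX0 => /eqP->; rewrite mul0r.
  exists r.+1, t; rewrite coefMX /= hornerMX qE exprS; split=> //; ring.
move=> _; exists 0%N, q.[x]; rewrite hornerMXaddC coefD coefMX coefC /= add0r.
by split=> //; ring.
Qed.

Lemma prime_low_term (A : comPzRingType) (P Q : primeIdeal A) (x c t : A) r :
  ~ P x -> Q x -> subideal P Q -> P (x ^+ r * (c + x * t)) -> Q c.
Proof.
move=> Px Qx PQ /(@prime_mul _ P)[/(@prime_exp _ P) //|/PQ].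
by apply: ideal_DKl; apply: ideal_Mr.
Qed.

Lemma univariate_low_term (K : fieldType) (n : nat) (w : 'I_n) (f : {mpoly K[n]}) :
  f != 0 -> exists r (c t : {mpoly K[n]}),
  [/\ c != 0, forall V, poly_in V f -> poly_in (V :\ w) c
    & f = 'X_w ^+ r * (c + 'X_w * t)].
Proof.
move=> f0; have [|r [t [c0 e]]] := @horner_low_term _ (univariate w f) 'X_w.
  by apply: contra f0 => /eqP/univariate_eq0->.
exists r, ((univariate w f)`_r), t; split; first exact c0.
  move=> V; exact: poly_in_univariate.
exact (etrans (esym (univariateK w f)) e).
Qed.

Section ChainDimension.
Variables (K : fieldType) (n : nat).
Implicit Types (f g : {mpoly K[n]}) (V W : {set 'I_n}).

Lemma poly_in_mod (I : ideal {mpoly K[n]}) V :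
  (forall a, exists2 g, poly_in V g & I ('X_a - g)) ->
  forall f, exists2 g, poly_in V g & I (f - g).
Proof.
move=> IV; have [|h hP] := boolp.choice (P := fun a g => poly_in V g /\ I ('X_a - g)).
  by move=> a; have [g Vg Ig] := IV a; exists g.
move=> f; exists (mpoly_eval h f).
  by apply: poly_in_eval (poly_in_setT f) _ => i _; case: (hP i).
have {1}-> : f = mpoly_eval (fun a => 'X_a) f.
  by rewrite (mpoly_eval_id (poly_in_setT f)).
by apply: mpoly_eval_mod => i; case: (hP i).
Qed.

(** Choosing [x i] in [p i.+1] outside [p i], a polynomial relation between the
    [x i] and the independent variables is peeled off one [x i] at a time: its lowest
    coefficient in [x i] lies in [p i.+1].  What remains in the end is a relation
    between the independent variables. *)
Theorem chain_dimension (p : nat -> primeIdeal {mpoly K[n]}) k V0 V :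
  prime_chain p k -> (forall a, exists2 g, poly_in V0 g & p 0%N ('X_a - g)) ->
  independent_mod (p k) V -> (k + #|V| <= #|V0|)%N.
Proof.
move=> pc gen0 indV; rewrite leqNgt; apply/negP => ltV0.
have [|x xP] := boolp.choice (P := fun i x => (i < k)%N -> p i.+1 x /\ ~ p i x).
  move=> i; apply: boolp.contrapT => nox.
  have [ik|] := boolp.EM (i < k)%N; last by move=> ?; apply: nox; exists 0.
  have [_ nle] := pc i ik; apply: nle => x px; apply: boolp.contrapT => npx.
  by apply: nox; exists x.
pose y (i : 'I_(k + #|V|)) : {mpoly K[n]} :=
  match split i with inl j => x j | inr j => 'X_(enum_val j) end.
have yl j : y (lshift #|V| j) = x j by rewrite /y (unsplitK (inl _ j)).
have yr j : y (rshift k j) = 'X_(enum_val j) by rewrite /y (unsplitK (inr _ j)).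
pose Z i : {set 'I_(k + #|V|)} := [set j : 'I__ | (i <= j)%N].
have [g gP] := boolp.choice (fun i => let: ex_intro2 g Vg Ig := poly_in_mod gen0 (y i) in
  ex_intro (fun g => poly_in V0 g /\ p 0%N (y i - g)) g (conj Vg Ig)).
have [|Q0 Q0_neq0 Q0g] := algebraic_dependence (g := g) ltV0.
  by move=> i; case: (gP i).
have Q0y : p 0%N (mpoly_eval y Q0).
  by rewrite -[mpoly_eval y Q0]subr0 -Q0g; apply: mpoly_eval_mod => i; case: (gP i).
have peel i : (i <= k)%N ->
    exists Q : {mpoly K[k + #|V|]}, [/\ Q != 0, poly_in (Z i) Q & p i (mpoly_eval y Q)].
  elim: i => [|i IHi] ik.
    by exists Q0; split=> //; apply: poly_inS _ (poly_in_setT _); apply/subsetP => j; rewrite inE.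
  have [Q [Q_neq0 ZQ pQ]] := IHi (ltnW ik).
  pose w := lshift #|V| (Ordinal ik).
  have [r [c [t [c0 Zc QE]]]] := univariate_low_term w Q_neq0.
  have [px npx] := xP i ik.
  exists c; split=> //.
    apply: poly_inS _ (Zc _ ZQ).
    apply/subsetP => j; rewrite !inE -(inj_eq val_inj) /= => /andP[ne le_ij].
    by rewrite ltn_neqAle eq_sym ne.
  have [le_p _] := pc i ik; apply: prime_low_term npx px le_p _.
  move: pQ; rewrite QE mpoly_evalM mpoly_evalD mpoly_evalM rmorphXn /= mpoly_evalX yl.
  by apply.
have [Q [Q_neq0 ZQ pQ]] := peel k (leqnn k).
have yV j : j \in Z k -> exists2 l, j = rshift k l & y j = 'X_(enum_val l).
  rewrite inE => kj; case: (split_ordP j) => l jE; last by exists l; rewrite ?jE.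
  by move: kj; rewrite jE /= leqNgt ltn_ord.
pose back a : {mpoly K[k + #|V|]} := \sum_(l < #|V| | enum_val l == a) 'X_(rshift k l).
have evQ0 : mpoly_eval y Q = 0.
  apply: indV => //; apply: poly_in_eval ZQ _ => j /yV[l _ ->].
  by apply: poly_inX; apply: enum_valP.
move/eqP: Q_neq0; apply; rewrite -(mpoly_eval_id (y := fun i => mpoly_eval back (y i)) ZQ).
  by rewrite -mpoly_eval_comp evQ0 rmorph0.
move=> j /yV[l jE ->]; rewrite mpoly_evalX /back jE (big_pred1 l) // => l'.
by rewrite (inj_eq enum_val_inj).
Qed.

End ChainDimension.

(** * Regular sequences from free variables *)

(** The coefficients of [q] are recovered from the top: each coefficient of
    [p * q] involves one of them multiplied by the leading coefficient of [p], and
    otherwise only higher ones. *)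
Lemma lead_coef_cancel (A : comNzRingType) (N : ideal A) (p q : {poly A}) :
  (forall t, N (p * q)`_t) -> exists k, forall r, N (lead_coef p ^+ k * q`_r).
Proof.
move=> Npq; exists (size q) => r.
have : (size q <= r + size q)%N by rewrite leq_addl.
elim: {2 3}(size q) r => [|j IHj] r.
  by rewrite addn0 => /(nth_default 0)->; rewrite mulr0; apply: ideal_0.
move=> qr; pose m := (size p).-1.
have : N (lead_coef p ^+ j * (p * q)`_(m + r)) by apply: ideal_M.
have lt_m : (m < (m + r).+1)%N by rewrite ltnS leq_addr.
rewrite coefM (bigD1 (Ordinal lt_m)) //= addKn -/(lead_coef p) mulrDr mulrA -exprSr.
move=> Nt; apply: ideal_DKl Nt; rewrite mulr_sumr; apply: ideal_sum => i ne_im.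
have [lt_mi|lt_im|eq_im] := ltngtP m i.
- rewrite [p`_i]nth_default ?mul0r ?mulr0; first exact: ideal_0.
  exact: leq_trans (leqSpred _) lt_mi.
- rewrite mulrCA; apply: ideal_M; apply: IHj; apply: leq_trans qr _; lia.
- by case/eqP: ne_im; apply: val_inj.
Qed.

Section NormalForm.
Variables (K : fieldType) (n : nat) (J : ideal {mpoly K[n]}) (D : {set 'I_n}).
Implicit Types (f g : {mpoly K[n]}) (V : {set 'I_n}) (N : ideal {mpoly K[n]}).

(** A linear choice of representatives modulo [J] that commutes with the
    variables of [D]: it witnesses that the quotient by [J] is free over the
    polynomial ring on [D]. *)
Record normal_form (nf : {mpoly K[n]} -> {mpoly K[n]}) : Prop := NormalForm {
  nf_mod : forall f, J (f - nf f);
  nf_D : forall f g, nf (f + g) = nf f + nf g;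
  nf_M : forall b f, poly_in D b -> nf (b * f) = b * nf f;
  nf_0 : forall f, J f -> nf f = 0
}.

Variable nf : {mpoly K[n]} -> {mpoly K[n]}.
Hypothesis nfP : normal_form nf.

(** For these ideals membership is inherited by the coefficients with respect to
    [x_w] of the normal form. *)
Definition coef_stable (w : 'I_n) N : Prop :=
  forall f, N f -> forall r, N ((univariate w (nf f))`_r).

Lemma coef_stable_base w : coef_stable w J.
Proof.
move=> f /(nf_0 nfP)-> r; rewrite (_ : univariate w 0 = 0) ?coef0; last exact: rmorph0.
exact: ideal_0.
Qed.

Lemma coef_stable_add w N V y : coef_stable w N -> w \notin V -> V \subset D ->
  poly_in V y -> coef_stable w (add_ideal N y).
Proof.
move=> Nw wV VD Vy f [a Na [b ->]] r.
rewrite (nf_D nfP) [b * y]mulrC (nf_M nfP); last exact: poly_inS VD Vy.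
rewrite univariateD univariateM (univariate_free wV Vy) coefD coefCM mulrC.
by exists ((univariate w (nf a))`_r); [apply: Nw | eexists].
Qed.

Lemma coef_stable_cancel w N y f : coef_stable w N -> subideal J N -> poly_in D y ->
  N (y * f) -> exists k, N (lead_coef (univariate w y) ^+ k * f).
Proof.
move=> Nw JN Dy Nyf.
have [|k Nk] := @lead_coef_cancel _ N (univariate w y) (univariate w (nf f)).
  by move=> t; rewrite -univariateM -(nf_M nfP) //; apply: Nw.
exists k; rewrite -[f](subrK (nf f)) mulrDr; apply: ideal_D.
  by apply: ideal_M; apply: JN; apply: nf_mod.
rewrite -[nf f in X in N X](univariateK w) horner_coef mulr_sumr.
by apply: ideal_sum => i _; rewrite mulrA; apply: ideal_Mr.
Qed.

Lemma independent0 (M : primeIdeal {mpoly K[n]}) : independent_mod M set0.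
Proof.
move=> f f0 Mf.
have fE : f = (f@_0%MM)%:MP.
  apply/mpolyP => m; rewrite mcoeffC.
  have [->|m0] := eqVneq m 0%MM; first by rewrite mulr1.
  rewrite mulr0; apply: memN_msupp_eq0; apply: contra m0 => /f0 m0.
  apply/eqP/mnmP => a; rewrite mnm0E; apply/eqP; apply: contraT => /m0.
  by rewrite inE.
rewrite fE; have [->|c0] := eqVneq f@_0%MM 0; first by rewrite mpolyC0.
case: (@prime_proper _ M); rewrite -[1](_ : (f@_0%MM)^-1%:MP * f = 1).
  exact: ideal_M.
by rewrite {2}fE -mpolyCM mulVf // mpolyC1.
Qed.

Lemma maximal_independent (M : primeIdeal {mpoly K[n]}) : exists V,
  [/\ V \subset D, independent_mod M V & forall w, w \in D :\: V ->
    exists y, [/\ poly_in (w |: V) y, M y & ~ M (lead_coef (univariate w y))]].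
Proof.
pose P V := boolp.asbool (V \subset D /\ independent_mod M V).
have P0 : P set0.
  by apply/boolp.asboolP; split; [apply: sub0set | apply: independent0].
case: (arg_maxnP (fun V : {set 'I_n} => #|V|) P0) => V /boolp.asboolP[VD indV] Vmax.
exists V; split=> // w; rewrite inE => /andP[wV wD].
have nind : ~ independent_mod M (w |: V).
  move=> indwV; have /Vmax : P (w |: V).
    by apply/boolp.asboolP; rewrite subUset sub1set wD VD.
  by rewrite /= cardsU1 wV add1n; apply/negP; rewrite -ltnNge.
have [y [wVy My y0]] : exists y, [/\ poly_in (w |: V) y, M y & y <> 0].
  apply: boolp.contrapT => noy; apply: nind => y wVy My.
  by apply: boolp.contrapT => y0; apply: noy; exists y.
exists y; split=> // Ml; apply: y0; apply: (univariate_eq0 (w := w)).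
apply/eqP; rewrite -lead_coef_eq0; apply/eqP; apply: indV => //.
by have := poly_in_univariate (w := w) (r := (size (univariate w y)).-1) wVy; rewrite setU1K.
Qed.

(** For each variable [w] algebraic over the chosen independent ones, [M] contains
    a polynomial in [w] whose leading coefficient is invertible at [M].  Adding this
    polynomial to an ideal keeps the ideal stable under coefficient extraction in
    the other variables, so the next polynomial can again be cancelled. *)
Theorem local_parameters (M : primeIdeal {mpoly K[n]}) : exists V s,
  [/\ V \subset D, independent_mod M V, (size s = #|D| - #|V|)%N,
      forall f, f \in s -> M f & locally_regular M J s].
Proof.
have [V [VD indV Vmax]] := maximal_independent M.
have [|y yP] := boolp.choice (P := fun w y => w \in D :\: V ->
    [/\ poly_in (w |: V) y, M y & ~ M (lead_coef (univariate w y))]).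
  move=> w; have [wDV|] := boolP (w \in D :\: V); last by exists 0.
  by have [y] := Vmax w wDV; exists y.
exists V, (map y (enum (D :\: V))); split=> //.
- by rewrite size_map -cardE cardsD (setIidPr VD).
- by move=> f /mapP[w]; rewrite mem_enum => /yP[_ My _] ->.
have reg ws N : uniq ws -> {subset ws <= D :\: V} -> subideal J N ->
    (forall w, w \in ws -> coef_stable w N) -> locally_regular M N (map y ws); last first.
  apply: reg; rewrite ?enum_uniq // => w; first by rewrite mem_enum.
  by move=> _; apply: coef_stable_base.
elim: ws N => [|w ws IHws] N //= /andP[w_ws uws] wsDV JN stN.
have wDV : w \in D :\: V by apply: wsDV; rewrite mem_head.
have [wVy My Ml] := yP w wDV; have [wV wD] : w \notin V /\ w \in D.
  by move: wDV; rewrite inE => /andP.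
have wVD : w |: V \subset D by rewrite subUset sub1set wD.
split.
  move=> f /(coef_stable_cancel (stN w (mem_head _ _)) JN (poly_inS wVD wVy))[k Nk].
  by exists (lead_coef (univariate w (y w)) ^+ k) => // /(@prime_exp _ M).
apply: IHws => //.
- by move=> v vws; apply: wsDV; rewrite inE vws orbT.
- by move=> f /JN; apply: sub_add_ideal.
move=> v vws; apply: (@coef_stable_add _ _ (w |: V)) => //.
  by apply: stN; rewrite inE vws orbT.
have := wsDV v; rewrite !inE vws orbT => /(_ isT)/andP[vV _].
by rewrite negb_or vV andbT; apply: contra w_ws => /eqP <-.
Qed.

End NormalForm.

(** * Monomial ideals *)

Section MonomialIdeals.
Variables (K : fieldType) (n : nat).
Implicit Types (f g : {mpoly K[n]}) (m u : 'X_{1..n}) (G : seq 'X_{1..n}).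

Section MonomialSpan.
Variable U : 'X_{1..n} -> Prop.
Hypothesis U_up : forall m1 m2, U m2 -> U (m1 + m2)%MM.

Let memM f g : supported U g -> supported U (f * g).
Proof.
by apply: (supportedM (G1 := fun=> True)) => // m1 m2 _; apply: U_up.
Qed.

Definition monomial_span : ideal {mpoly K[n]} :=
  Ideal (supported0 U) (@supportedD _ _ U) memM.
End MonomialSpan.

Definition above G m : bool := has (fun u => (u <= m)%MM) G.

Lemma above_addl G m1 m2 : above G m2 -> above G (m1 + m2)%MM.
Proof.
by move=> /hasP[u uG um]; apply/hasP; exists u => //; apply: lepm_trans um (lem_addl _ _).
Qed.

Lemma above_le G m1 m2 : above G m1 -> (m1 <= m2)%MM -> above G m2.
Proof.
by move=> /hasP[u uG um] le12; apply/hasP; exists u => //; apply: lepm_trans um le12.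
Qed.

Lemma monomial_ideal_above G m : above G m -> monomial_ideal K G 'X_[m].
Proof.
move=> /hasP[u uG um]; rewrite -(submK um) mpolyXD; apply: ideal_M.
by apply: mem_ideal_gen; apply: map_f.
Qed.

Lemma monomial_idealP G f : monomial_ideal K G f <-> supported (above G) f.
Proof.
split=> [|Gf].
  apply: (@ideal_gen_le _ _ (monomial_span (@above_addl G))) => _ /mapP[u uG ->].
  by apply: supportedX; apply/hasP; exists u => //; apply: lepm_refl.
rewrite [f]mpolyE big_seq; apply: ideal_sum => m /Gf Gm.
by rewrite -mul_mpolyC; apply: ideal_M; apply: monomial_ideal_above.
Qed.

Definition truncation G f := \sum_(m <- msupp f | ~~ above G m) f@_m *: 'X_[m].

Lemma truncation_mod G f : monomial_ideal K G (f - truncation G f).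
Proof.
rewrite {1}[f]mpolyE (bigID (above G)) -/(truncation G f) addrK; apply: ideal_sum => m Gm.
by rewrite -mul_mpolyC; apply: ideal_M; apply: monomial_ideal_above.
Qed.

Lemma supported_truncation G (H : 'X_{1..n} -> Prop) f : supported H f ->
  supported (fun m => H m /\ ~~ above G m) (truncation G f).
Proof.
move=> Hf; rewrite /truncation big_seq_cond; apply: supported_sum => m /andP[mf Gm].
by apply: supportedZ; apply: supportedX; split=> //; apply: Hf.
Qed.

Lemma split_variable (w : 'I_n) f : exists f0 f1, [/\ f = f0 + 'X_w * f1,
  supported (fun m => m \in msupp f /\ m w = 0%N) f0
  & supported (fun m => (U_(w) + m)%MM \in msupp f) f1].
Proof.
exists (\sum_(m <- msupp f | m w == 0%N) f@_m *: 'X_[m]).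
exists (\sum_(m <- msupp f | m w != 0%N) f@_m *: 'X_[m - U_(w)]); split.
- rewrite {1}[f]mpolyE (bigID (fun m : 'X_{1..n} => m w == 0%N)) /=; congr (_ + _).
  rewrite mulr_sumr; apply: eq_bigr => m mw; rewrite -scalerAr -mpolyXD.
  by rewrite addmC submK // lep1mP.
- rewrite big_seq_cond; apply: supported_sum => m /andP[mf /eqP mw].
  by apply: supportedZ; apply: supportedX.
- rewrite big_seq_cond; apply: supported_sum => m /andP[mf mw].
  by apply: supportedZ; apply: supportedX; rewrite addmC submK // lep1mP.
Qed.

(** The lowest monomial of [f] survives in [u * f] when [u] has a nonzero constant
    term. *)
Lemma local_supported (U : 'X_{1..n} -> Prop) (u f : {mpoly K[n]}) : u@_0%MM != 0 -> supported U (u * f) ->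
  supported (fun m => ~ U m) f -> f = 0.
Proof.
move=> u0 Uuf Uf; apply/eqP; apply: contraT => f0.
have mf := mlast_supp f0; case: (Uf _ mf); apply: (supported_neq0 Uuf).
rewrite mcoeffM.
have lt0 : (mdeg (0%MM : 'X_{1..n}) < (mdeg (mlast f)).+1)%N by rewrite mdeg0.
pose i0 : 'X_{1..n < _, _} := (BMultinom lt0, BMultinom (ltnSn (mdeg (mlast f)))).
rewrite (bigD1 i0) /= ?add0m // big1 ?addr0.
  by rewrite mulf_neq0 // -mcoeff_msupp.
move=> [k1 k2] /= /andP[/eqP e ne].
have [k2f|/memN_msupp_eq0->] := boolP (bmnm k2 \in msupp f); last by rewrite mulr0.
have le1 := mlast_lemc k2f.
have le2 : (bmnm k2 <= mlast f)%O by have := lemc_addl k1 k2; rewrite -e.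
have k2E : bmnm k2 = mlast f by apply/eqP; rewrite eq_le le1 le2.
case/eqP: ne; rewrite /i0; congr pair; apply: val_inj => //=.
by rewrite k2E in e; apply: (@addIm _ (mlast f)); rewrite add0m -e.
Qed.

End MonomialIdeals.

(** * Coordinate primes *)

Section CoordinatePrimes.
Variables (K : fieldType) (n : nat).
Implicit Types (f g : {mpoly K[n]}) (W : {set 'I_n}).

Section ZeroPrime.
Let zero1 : ~ zero_ideal {mpoly K[n]} 1.
Proof. by move/eqP; rewrite oner_eq0. Qed.

Let zeroP f g : zero_ideal {mpoly K[n]} (f * g) ->
  zero_ideal {mpoly K[n]} f \/ zero_ideal {mpoly K[n]} g.
Proof. by move/eqP; rewrite mulf_eq0 => /orP[]/eqP; [left | right]. Qed.

Definition zero_prime : primeIdeal {mpoly K[n]} := PrimeIdeal zero1 zeroP.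
End ZeroPrime.

(** The prime generated by the variables of [W]. *)
Definition coordinate_prime W : primeIdeal {mpoly K[n]} :=
  contract_prime (mpoly_eval (fun a => if a \in W then 0 else 'X_a)) zero_prime.

Lemma coordinate_primeX W a : coordinate_prime W 'X_a <-> a \in W.
Proof.
rewrite /= mpoly_evalX; case: ifP => // _; split=> // /eqP.
by rewrite -msize_poly_eq0 msizeX.
Qed.

Lemma coordinate_prime_le W W' : W \subset W' ->
  subideal (coordinate_prime W) (coordinate_prime W').
Proof.
move=> /subsetP WW' f /= fW.
pose z a : {mpoly K[n]} := if a \in W' then 0 else 'X_a.
have -> : mpoly_eval z f = mpoly_eval z (mpoly_eval (fun a => if a \in W then 0 else 'X_a) f).
  rewrite mpoly_eval_comp; congr (mpoly_eval _ f); apply: boolp.funext => a.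
  rewrite /z; case: ifP => aW'; case: ifP => aW; rewrite ?rmorph0 ?mpoly_evalX ?aW' //.
  by rewrite WW' in aW'.
by rewrite fW rmorph0.
Qed.

Lemma coordinate_prime_lt W W' : W \proper W' ->
  strict_subideal (coordinate_prime W) (coordinate_prime W').
Proof.
move=> /properP[WW' [a aW' aW]]; split; first exact: coordinate_prime_le.
move=> le; move: aW; apply/negP; rewrite negbK; apply/coordinate_primeX/le.
exact/coordinate_primeX.
Qed.

Lemma coordinate_prime_monomial W (m : 'X_{1..n}) a : a \in W -> m a != 0%N ->
  coordinate_prime W 'X_[m].
Proof.
move=> aW ma; have -> : m = (m - U_(a) + U_(a))%MM by rewrite submK // lep1mP.
by rewrite mpolyXD; apply: ideal_M; apply/coordinate_primeX.
Qed.

Lemma eval_origin f : mpoly_eval (fun=> 0) f = (f@_0%MM)%:MP_[n].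
Proof.
move: f; apply: mpoly_ind_ring => [c|a|f g ef eg|f g ef eg].
- by rewrite mpoly_evalC mcoeffC eqxx mulr1.
- by rewrite mpoly_evalX mcoeffX mnm1_eq0.
- by rewrite mpoly_evalD ef eg -mpolyCD mcoeffD.
- by rewrite mpoly_evalM ef eg -mpolyCM; congr (_%:MP); rewrite rmorphM.
Qed.

Definition origin_prime : primeIdeal {mpoly K[n]} := coordinate_prime setT.

Lemma origin_primeE f : origin_prime f <-> f@_0%MM = 0.
Proof.
rewrite /= (_ : (fun a => _) = (fun=> 0)); last first.
  by apply: boolp.funext => a; rewrite inE.
by rewrite eval_origin; split=> [/eqP|->]; [rewrite mpolyC_eq0 => /eqP | rewrite mpolyC0].
Qed.

End CoordinatePrimes.

(** * Identification of variables *)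

Section Identification.
Variables (n : nat) (G : seq 'X_{1..n}) (rho : 'I_n -> 'I_n) (R : {set 'I_n}).
Hypothesis rho_id : forall r, r \in R -> rho r = r.
Hypothesis rho_G : forall u a, u \in G -> u a != 0%N -> rho a \in R.
Implicit Types (m u : 'X_{1..n}).

Definition pushforward u : 'X_{1..n} := (\sum_a U_(rho a) *+ u a)%MM.

Lemma pushforward_in u : u \in G -> mono_in R (pushforward u).
Proof.
move=> uG r; rewrite /pushforward mnm_sumE sum_nat_eq0 negb_forall => /existsP[a] /=.
by rewrite mulmnE mnm1E; have [<- ua|//] := eqVneq (rho a) r; apply: (rho_G uG); lia.
Qed.

(** The monomials that survive when each variable is replaced by its
    representative. *)
Definition reduced m : bool := ~~ above (map pushforward G) m.

Lemma reduced_le m1 m2 : (m1 <= m2)%MM -> reduced m2 -> reduced m1.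
Proof. by move=> le12; apply: contra => /above_le; apply. Qed.

Lemma reduced_addl m1 m2 : mono_in (~: R) m1 -> reduced m2 -> reduced (m1 + m2)%MM.
Proof.
move=> Rm1; apply: contra => /hasP[_ /mapP[u uG ->] le]; apply/hasP.
exists (pushforward u); first exact: map_f.
apply/mnm_lepP => a; have := mnm_lepP le a; rewrite mnmDE.
have [m1a|/Rm1] := eqVneq (m1 a) 0%N; first by rewrite m1a.
rewrite inE => aR _; have [->//|/(pushforward_in uG)] := eqVneq (pushforward u a) 0%N.
by move=> ua; rewrite ua in aR.
Qed.

Definition rep_degree m : nat := (\sum_(r in R) m r)%N.

Lemma rep_degreeD m1 m2 : rep_degree (m1 + m2)%MM = (rep_degree m1 + rep_degree m2)%N.
Proof. by rewrite -big_split; apply: eq_bigr => r _; rewrite mnmDE. Qed.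

Lemma rep_degree_le m : (rep_degree m <= mdeg m)%N.
Proof. by rewrite mdegE [leqRHS](bigID (mem R)) leq_addr. Qed.

Lemma rep_degree_in m : mono_in R m -> rep_degree m = mdeg m.
Proof.
move=> Rm; rewrite mdegE [RHS](bigID (mem R)) /= [X in (_ + X)%N]big1 ?addn0 //.
by move=> a aR; apply/eqP; apply: contraT => /Rm; rewrite (negPf aR).
Qed.

Section OverField.
Variable K : fieldType.
Implicit Types (f g : {mpoly K[n]}).

Definition representative (a : 'I_n) : {mpoly K[n]} :=
  if (a \notin R) && (rho a \in R) then 'X_(rho a) else 0.

Definition twist : {mpoly K[n]} -> {mpoly K[n]} :=
  mpoly_eval (fun a => 'X_a - representative a).
Definition untwist : {mpoly K[n]} -> {mpoly K[n]} :=
  mpoly_eval (fun a => 'X_a + representative a).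

HB.instance Definition _ := GRing.RMorphism.on twist.
HB.instance Definition _ := GRing.RMorphism.on untwist.

Lemma representative_rep r : r \in R -> representative r = 0.
Proof. by rewrite /representative => ->. Qed.

Lemma eval_representative (y : 'I_n -> {mpoly K[n]}) a :
  (forall r, r \in R -> y r = 'X_r) -> mpoly_eval y (representative a) = representative a.
Proof.
move=> yR; rewrite /representative; case: ifP => [/andP[_ ra]|_]; last exact: rmorph0.
by rewrite mpoly_evalX yR.
Qed.

Lemma untwistK : cancel untwist twist.
Proof.
move=> f; rewrite /twist /untwist mpoly_eval_comp.
apply: (mpoly_eval_id (poly_in_setT f)) => a _.
rewrite mpoly_evalD mpoly_evalX eval_representative ?subrK // => r rR.
by rewrite representative_rep // subr0.
Qed.

Lemma twistK : cancel twist untwist.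
Proof.
move=> f; rewrite /twist /untwist mpoly_eval_comp.
apply: (mpoly_eval_id (poly_in_setT f)) => a _.
rewrite mpoly_evalB mpoly_evalX eval_representative ?addrK // => r rR.
by rewrite representative_rep // addr0.
Qed.

Local Notation J := (monomial_ideal K G).

(** [twist] makes the linear forms [x_a - x_(rho a)] into the variables outside
    [R]. *)
Definition twisted_ideal : ideal {mpoly K[n]} := contract twist J.
Local Notation J' := twisted_ideal.

Lemma twisted_untwist f : J' (untwist f) <-> J f.
Proof. by rewrite /twisted_ideal /= untwistK. Qed.

Lemma supported_representative a :
  supported (fun m => mdeg m <= 1)%N (representative a).
Proof.
rewrite /representative; case: ifP => _; last exact: supported0.
by apply: supportedX; rewrite mdeg1.
Qed.

Lemma twist_deg m : supported (fun m' => mdeg m' <= mdeg m)%N (twist 'X_[m]).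
Proof.
rewrite /twist mpoly_evalXm mdegE; apply: supported_deg_prod => a.
rewrite -[m a in X in supported X]muln1; apply: supported_deg_exp.
apply: supportedD; first by apply: supportedX; rewrite mdeg1.
by apply: supportedN; apply: supported_representative.
Qed.

(** A relation compatible with products, through which the top part of [untwist]
    in the representatives is computed one variable at a time. *)
Definition leads f s : Prop :=
  supported (fun m => mdeg m <= mdeg s /\ rep_degree m < mdeg s)%N (f - 'X_[s]).

Lemma leads1 : leads 1 0%MM.
Proof. by rewrite /leads mpolyX0 subrr; apply: supported0. Qed.

Lemma leadsM f1 s1 f2 s2 : leads f1 s1 -> leads f2 s2 -> leads (f1 * f2) (s1 + s2)%MM.
Proof.
rewrite /leads => L1 L2.
have -> : f1 * f2 - 'X_[s1 + s2] = f2 * (f1 - 'X_[s1]) + 'X_[s1] * (f2 - 'X_[s2]).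
  by rewrite mpolyXD mulr_sub_mul.
have B2 : supported (fun m => mdeg m <= mdeg s2 /\ rep_degree m <= mdeg s2)%N f2.
  rewrite -(subrK 'X_[s2] f2); apply: supportedD.
    by apply: supportedS L2 => m [dm rm]; split=> //; apply: ltnW.
  by apply: supportedX; split=> //; apply: rep_degree_le.
have B1 : supported (fun m => mdeg m <= mdeg s1 /\ rep_degree m <= mdeg s1)%N
    ('X_[s1] : {mpoly K[n]}).
  by apply: supportedX; split=> //; apply: rep_degree_le.
apply: supportedD.
  apply: supportedM B2 L1 => m1 m2 [d1 r1] [d2 r2].
  by rewrite !mdegD rep_degreeD; split; lia.
apply: supportedM B1 L2 => m1 m2 [d1 r1] [d2 r2].
by rewrite !mdegD rep_degreeD; split; lia.
Qed.

Lemma leadsX a : rho a \in R -> leads ('X_a + representative a) U_(rho a)%MM.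
Proof.
move=> ra; rewrite /leads /representative ra andbT; case: ifP => [aR|/negbFE aR].
  rewrite addrK; apply: supportedX; rewrite !mdeg1; split=> //.
  rewrite /rep_degree big1 // => r rR; rewrite mnm1E.
  by have [ar|] := eqVneq a r; first by rewrite ar rR in aR.
by rewrite rho_id // addr0 subrr; apply: supported0.
Qed.

(** [untwist] replaces each variable by its representative, up to terms with
    fewer representatives. *)
Lemma untwist_leads u : u \in G -> leads (untwist 'X_[u]) (pushforward u).
Proof.
move=> uG; rewrite /untwist mpoly_evalXm.
apply: (big_ind2 leads); first exact: leads1.
  by move=> *; apply: leadsM.
move=> a _; have [->|/(rho_G uG) ra] := eqVneq (u a) 0%N.
  by rewrite expr0 mulm0n; apply: leads1.
elim: (u a) => [|k IHk]; first by rewrite expr0 mulm0n; apply: leads1.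
by rewrite exprS mulmS; apply: leadsM => //; apply: leadsX.
Qed.

Definition reduced_upto t f : Prop := supported (fun m => reduced m /\ mdeg m <= t)%N f.

(** A monomial that is not reduced is a multiple of some [pushforward u]; modulo
    [J'] it can be replaced by terms with fewer representatives and no larger
    degree. *)
Lemma reduced_span t f : supported (fun m => mdeg m <= t)%N f ->
  exists2 g, reduced_upto t g & J' (f - g).
Proof.
have combine (s : seq 'X_{1..n}) (c : 'X_{1..n} -> K) :
    (forall m, m \in s -> exists2 g, reduced_upto t g & J' ('X_[m] - g)) ->
    exists2 g, reduced_upto t g & J' (\sum_(m <- s) c m *: 'X_[m] - g).
  elim: s => [|m s IHs] sP.
    by exists 0; [apply: supported0 | rewrite big_nil subrr; apply: ideal_0].
  have [g tg Jg] : exists2 g, reduced_upto t g & J' ('X_[m] - g).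
    by apply: sP; rewrite mem_head.
  have [|h th Jh] := IHs; first by move=> m' m's; apply: sP; rewrite inE m's orbT.
  exists (c m *: g + h); first by apply: supportedD => //; apply: supportedZ.
  rewrite big_cons opprD addrACA; apply: ideal_D => //.
  by rewrite -scalerBr -mul_mpolyC; apply: ideal_M.
suff mon k m : (mdeg m <= t)%N -> (rep_degree m < k)%N ->
    exists2 g, reduced_upto t g & J' ('X_[m] - g).
  move=> tf; rewrite [f]mpolyE; apply: combine => m /tf tm.
  exact: mon (rep_degree m).+1 _ _ _.
elim: k m => // k IHk m tm; rewrite ltnS => rm.
have [redm|] := boolP (reduced m).
  exists 'X_[m]; first by apply: supportedX.
  by rewrite subrr; apply: ideal_0.
rewrite negbK => /hasP[_ /mapP[u uG ->] le_um].
pose e := untwist 'X_[u] - 'X_[pushforward u] : {mpoly K[n]}.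
pose d := (m - pushforward u)%MM.
have mE : m = (d + pushforward u)%MM by rewrite submK.
have dsup : supported (fun m' => mdeg m' <= mdeg d /\ rep_degree m' <= rep_degree d)%N
    ('X_[d] : {mpoly K[n]}).
  by apply: supportedX.
have desup : supported (fun m' => mdeg m' <= t /\ rep_degree m' < k)%N ('X_[d] * e).
  apply: supportedM dsup (untwist_leads uG) => m1 m2 [d1 r1] [d2 r2].
  rewrite mdegD rep_degreeD; move: tm rm; rewrite mE mdegD rep_degreeD.
  by rewrite (rep_degree_in (pushforward_in uG)); lia.
have [|g tg Jg] := combine (msupp ('X_[d] * e)) (fun m' => ('X_[d] * e)@_m').
  by move=> m' /desup[]; apply: IHk.
exists (- g); first exact: supportedN.
rewrite -mpolyE in Jg.
have -> : 'X_[m] - - g = 'X_[d] * untwist 'X_[u] - ('X_[d] * e - g).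
  rewrite /e mulrBr -mpolyXD -mE; move: ('X_[d] * _) => x; rewrite !opprB opprK.
  by rewrite addrC [RHS]addrC addrA subrK.
apply: ideal_B => //; apply: ideal_M; apply/twisted_untwist.
by apply: mem_ideal_gen; apply: map_f.
Qed.

(** Reduced monomials form a union of translates of monomials in the
    representatives by all monomials outside [R]; since they span, their independence
    modulo [J'] means that the quotient is free over the polynomial ring on the
    variables outside [R]. *)
Definition reduced_free : Prop :=
  forall f, supported reduced f -> J' f -> f = 0.

(** The normal form of [f] is its unique reduced representative; products with
    polynomials outside [R] preserve reduced polynomials. *)
Lemma reduced_free_normal_form : reduced_free -> exists nf, normal_form J' (~: R) nf.
Proof.
move=> free.
have [|nf nfP] := boolp.choice (P := fun f g => supported reduced g /\ J' (f - g)).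
  move=> f; have [|g tg Jg] := @reduced_span (msize f) f.
    by move=> m /msize_mdeg_lt/ltnW.
  by exists g; split=> //; apply: supportedS tg => m [].
have uniq f g : supported reduced g -> J' (f - g) -> nf f = g.
  move=> rg Jg; apply/eqP; rewrite -subr_eq0; apply/eqP; apply: free.
    by apply: supportedD; [case: (nfP f) | apply: supportedN].
  have [_ Jf] := nfP f.
  by have := ideal_B Jg Jf; rewrite opprB addrC addrA subrK.
exists nf; split.
- by move=> f; case: (nfP f).
- move=> f g; have [rf Jf] := nfP f; have [rg Jg] := nfP g.
  apply: uniq; first exact: supportedD.
  by rewrite opprD addrACA; apply: ideal_D.
- move=> b f Db; have [rf Jf] := nfP f; apply: uniq.
    by apply: supportedM Db rf => m1 m2; apply: reduced_addl.
  by rewrite -mulrBr; apply: ideal_M.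
- by move=> f Jf; apply: uniq; rewrite ?subr0 //; apply: supported0.
Qed.

End OverField.
End Identification.

(** * Freeness as a comparison of cardinalities *)

Lemma mulr_drop (A : comPzRingType) (u a b x : A) :
  u * a = u * (a + x * b) + - (u * b) * x.
Proof. by ring. Qed.

Section Freeness.
Variables (n : nat) (G : seq 'X_{1..n}) (rho : 'I_n -> 'I_n) (R : {set 'I_n}).
Hypothesis rho_id : forall r, r \in R -> rho r = r.
Hypothesis rho_G : forall u a, u \in G -> u a != 0%N -> rho a \in R.
Implicit Types (m : 'X_{1..n}).

Section RegularToFree.
Variable K : fieldType.
Implicit Types (f g u : {mpoly K[n]}).
Local Notation J := (monomial_ideal K G).
Local Notation J' := (twisted_ideal G rho R K).
Local Notation M := (origin_prime K n).

(** A multiple of [f] in [N] is split as [f0 + x_w * f1].  Modulo [x_w] only [f0]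
    remains and vanishes by induction on the sequence; then [x_w] is cancelled by
    regularity and [f1] has smaller degree. *)
Lemma peel_regular (ws : seq 'I_n) (N : ideal {mpoly K[n]}) (X : {set 'I_n}) :
  locally_regular M N [seq 'X_w | w <- ws] ->
  (forall f u, supported (fun m => reduced G rho m /\ mono_in (~: (X :|: [set a in ws])) m) f ->
     ~ M u -> add_ideals N [seq 'X_w | w <- ws] (u * f) -> f = 0) ->
  forall f u, supported (fun m => reduced G rho m /\ mono_in (~: X) m) f ->
    ~ M u -> N (u * f) -> f = 0.
Proof.
elim: ws N X => [|w ws IHws] N X /=.
  move=> _ base f u rf Mu Nuf; apply: base Mu Nuf.
  by apply: supportedS rf => m [rm Xm]; split=> // a /Xm; rewrite !inE orbF.
move=> [Nw rws] base f.
have [k] := ubnP (msize f); elim: k f => // k IHk f lt_fk u rf Mu Nuf.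
have [f0 [f1 [fE f0P f1P]]] := split_variable w f.
have f00 : f0 = 0.
  apply: (IHws (add_ideal N 'X_w) (w |: X) rws _ f0 u) => //.
  - move=> g v rg; apply: base; apply: supportedS rg => m [rm Xm]; split=> // a /Xm.
    by rewrite !inE !negb_or => /andP[/andP[-> ->] ->].
  - move=> m /f0P[/rf[rm Xm] mw]; split=> // a ma; have := Xm a ma.
    rewrite !inE negb_or => ->; rewrite andbT; apply: contra ma => /eqP->.
    by rewrite mw.
  - exists (u * f); first by [].
    by exists (- (u * f1)); rewrite fE; apply: mulr_drop.
have [f10|f1_neq0] := eqVneq f1 0; first by rewrite fE f00 f10 mulr0 addr0.
have /Nw[v Mv Nvuf] : N ('X_w * (u * f1)).
  by move: Nuf; rewrite fE f00 add0r mulrCA.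
have f10 : f1 = 0.
  apply: (IHk f1 _ (v * u)).
  - have /mlead_supp/f1P/msize_mdeg_lt := f1_neq0.
    rewrite mdegD mdeg1 add1n mlead_deg // => /leq_trans; apply; exact: lt_fk.
  - move=> m /f1P/rf[rm Xm]; split; first exact: reduced_le (lem_addl _ _) rm.
    by move=> a ma; apply: Xm; rewrite mnmDE addn_eq0 negb_and ma orbT.
  - by move=> /(@prime_mul _ M)[].
  - by rewrite -mulrA.
by rewrite f10 eqxx in f1_neq0.
Qed.

Definition collapse : {mpoly K[n]} -> {mpoly K[n]} :=
  mpoly_eval (fun a => if a \in ~: R then 0 else 'X_a).

HB.instance Definition _ := GRing.RMorphism.on collapse.

Lemma collapse_untwist (u : 'X_{1..n}) : u \in G -> collapse (untwist rho R 'X_[u]) = 'X_[pushforward rho u].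
Proof.
move=> uG; rewrite /collapse /untwist mpoly_eval_comp mpoly_evalXm.
rewrite /pushforward -mprodXnE; apply: eq_bigr => a _.
have [->|/(rho_G uG) ra] := eqVneq (u a) 0%N; first by rewrite !expr0.
congr (_ ^+ _); rewrite mpoly_evalD mpoly_evalX /representative ra andbT inE.
have [aR|aR] := boolP (a \in R); first by rewrite /= rho_id // rmorph0 addr0.
by rewrite /= mpoly_evalX inE ra add0r.
Qed.

(** Once all variables outside [R] are set to zero, [J'] becomes the ideal of the
    monomials [pushforward u], which contains no nonzero polynomial with reduced support. *)
Lemma locally_regular_free :
  locally_regular M J' [seq 'X_w | w <- enum (~: R)] -> reduced_free G rho R K.
Proof.
move=> reg f rf Jf.
apply: (@peel_regular (enum (~: R)) J' set0 reg _ f 1); last by rewrite mul1r.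
- move=> {rf Jf}f u rf /origin_primeE u0 Nuf.
  pose U := monomial_span K (@above_addl _ (map (pushforward rho) G)).
  have kf : collapse f = f.
    have Rf : poly_in R f.
      move=> m /rf[_ Rm] a /Rm; rewrite !inE mem_enum inE negbK //.
    by apply: mpoly_eval_id Rf _ => a aR; rewrite inE aR.
  have /= : contract collapse U (u * f).
    move: Nuf; apply: add_ideals_le.
      move=> g Jg; rewrite -(@twistK n rho R K g); have {}Jg : J (twist rho R g) by [].
      move: (twist rho R g) Jg => h Jh.
      have : contract (@untwist _ rho R K) (contract collapse U) h.
        move: Jh; apply: ideal_gen_le => _ /mapP[v vG ->].
        suff : U (collapse (untwist rho R 'X_[v])) by [].
        rewrite collapse_untwist //; apply: supportedX; apply/hasP.
        by exists (pushforward rho v); [apply: map_f | apply: lepm_refl].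
      by [].
    move=> _ /mapP[w wR ->]; rewrite mem_enum in wR.
    suff : U (collapse 'X_w) by [].
    by rewrite /collapse mpoly_evalX wR; apply: ideal_0.
  rewrite {1}/collapse mpoly_evalM -/collapse kf => Ukuf.
  apply: local_supported Ukuf _; last by move=> m /rf[rm _]; apply/negP.
  have : mpoly_eval (fun=> 0) (collapse u) = mpoly_eval (fun=> 0) u :> {mpoly K[n]}.
    rewrite /collapse mpoly_eval_comp; congr (mpoly_eval _ u); apply: boolp.funext => a.
    by case: ifP; rewrite ?rmorph0 ?mpoly_evalX.
  by rewrite !eval_origin => /eqP; rewrite mpolyC_eq => /eqP->; apply/eqP.
- by move=> m mf; split; [apply: rf | move=> a _; rewrite !inE].
- by move/origin_primeE; rewrite mcoeff1 eqxx => /eqP; rewrite oner_eq0.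
Qed.

End RegularToFree.

(** These two numbers decide freeness, and no field enters them: the monomials
    counted by [count_standard] are a basis of the quotient in degrees at most [t],
    those counted by [count_reduced] always span it. *)
Definition count_reduced t := #|[pred m : 'X_{1..n < t.+1} | reduced G rho m]|.
Definition count_standard t := #|[pred m : 'X_{1..n < t.+1} | ~~ above G m]|.

Section Counting.
Variable K : fieldType.
Implicit Types (f g u : {mpoly K[n]}).
Local Notation J := (monomial_ideal K G).
Local Notation J' := (twisted_ideal G rho R K).

Lemma monomial_independent (b : nat) (P : pred 'X_{1..n < b})
    (c : {m | P m} -> K) :
  \sum_j c j *: 'X_[val j] = 0 :> {mpoly K[n]} -> forall j, c j = 0.
Proof.
move=> sum0 j; move/mpolyP/(_ (bmnm (val j))): sum0.
rewrite mcoeff0 raddf_sum (bigD1 j) //= mcoeffZ mcoeffX eqxx mulr1 big1 ?addr0 //.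
move=> i ne; rewrite mcoeffZ mcoeffX; case: eqP => [e|]; last by rewrite mulr0.
by case/eqP: ne; apply/val_inj/val_inj.
Qed.

(** Truncating their twists embeds the span of the reduced monomials into the
    span of the monomials outside [J]. *)
Lemma reduced_free_count t : reduced_free G rho R K -> (count_reduced t <= count_standard t)%N.
Proof.
move=> free; rewrite leqNgt; apply/negP => lt_sr.
pose T := {m : 'X_{1..n < t.+1} | reduced G rho m}.
pose F (m : T) : {mpoly K[n]} := truncation G (twist rho R 'X_[val m]).
pose E := image (@bmnm n t.+1) [pred m : 'X_{1..n < t.+1} | ~~ above G m].
have FE (m : T) : supported (fun m' => m' \in E) (F m).
  have := @supported_truncation _ _ G _ _ (@twist_deg n rho R K (val m)).
  apply: supportedS => m' [dm' Gm'].
  have lt_m' : (mdeg m' < t.+1)%N by apply: leq_ltn_trans dm' (bmdeg _).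
  by apply/imageP; exists (BMultinom lt_m').
have [|c [[m0 cm0] sumF]] := linear_relation FE.
  by rewrite size_image card_sig.
have Jsum : J (\sum_m c m *: twist rho R 'X_[val m]).
  have -> : \sum_m c m *: twist rho R 'X_[val m] =
      \sum_m c m *: twist rho R 'X_[val m] - \sum_m c m *: F m.
    by rewrite sumF subr0.
  rewrite -sumrB; apply: ideal_sum => m _.
  by rewrite -scalerBr -mul_mpolyC; apply: ideal_M; apply: truncation_mod.
have sum0 : \sum_m c m *: 'X_[val m] = 0 :> {mpoly K[n]}.
  apply: free.
    apply: supported_sum => m _; apply: supportedZ; apply: supportedX.
    exact: (valP m).
  rewrite /twisted_ideal /=.
  have -> : twist rho R (\sum_m c m *: 'X_[val m]) =
      \sum_m twist rho R (c m *: 'X_[val m]) by exact: rmorph_sum.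
  by under eq_bigr => m _ do rewrite /twist mpoly_evalZ.
by move: cm0; rewrite (monomial_independent sum0 m0) eqxx.
Qed.

(** A relation would express every standard monomial by the reduced monomials
    other than its leading one [m0], which are too few. *)
Lemma count_reduced_free :
  (forall t, (count_reduced t <= count_standard t)%N) -> reduced_free G rho R K.
Proof.
move=> le_rs f rf Jf; apply/eqP; apply: contraT => f0.
have m0f := mlead_supp f0; set m0 := mlead f in m0f.
pose t := msize f.
have lt_m0 : (mdeg m0 < t.+1)%N by rewrite ltnS ltnW // msize_mdeg_lt.
have tf : reduced_upto G rho t f.
  by move=> m mf; split; [apply: rf | apply: ltnW; apply: msize_mdeg_lt].
pose T := {m : 'X_{1..n < t.+1} | ~~ above G m}.
have [|h hP] := boolp.choice (P := fun (y : T) g => [/\ reduced_upto G rho t g, g@_m0 = 0 &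
    J' (untwist rho R 'X_[val y] - g)]).
  move=> y; pose v : {mpoly K[n]} := untwist rho R 'X_[val y].
  have tv : supported (fun m => mdeg m <= t)%N v.
    have -> : v = mpoly_eval (fun a => 'X_a + representative rho R K a) 'X_[val y] by [].
    rewrite mpoly_evalXm.
    have lt_y : (mdeg (bmnm (val y)) <= t)%N by rewrite -ltnS bmdeg.
    apply: supportedS (supported_deg_prod (d := fun a => (bmnm (val y) a * 1)%N) _).
      move=> m /leq_trans; apply; apply: leq_trans lt_y; rewrite mdegE.
      by apply: leq_sum => a _; rewrite muln1.
    move=> a; apply: supported_deg_exp; apply: supportedD.
      by apply: supportedX; rewrite mdeg1.
    exact: supported_representative.
  have [g tg Jg] := reduced_span rho_id rho_G tv.
  have fm0 : f@_m0 != 0 by rewrite -mcoeff_msupp.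
  exists (g - (g@_m0 / f@_m0) *: f); split.
  - by apply: supportedD => //; apply: supportedN; apply: supportedZ.
  - by rewrite mcoeffB mcoeffZ divfK // subrr.
  - rewrite opprB addrCA addrC; apply: ideal_D => //.
    by rewrite -mul_mpolyC; apply: ideal_M.
pose E := image (@bmnm n t.+1)
  [pred m : 'X_{1..n < t.+1} | reduced G rho m && (bmnm m != m0)].
have hE y : supported (fun m => m \in E) (h y).
  have [ty h0 _] := hP y; move=> m mh; have [rm dm] := ty m mh.
  have lt_m : (mdeg m < t.+1)%N by [].
  apply/imageP; exists (BMultinom lt_m) => //; rewrite !inE /= rm.
  by apply: contraL mh => /eqP->; rewrite mcoeff_msupp h0 eqxx.
have [|c [[y0 cy0] sumh]] := linear_relation hE.
  rewrite size_image card_sig.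
  set A := (X in (#|X| < _)%N); pose B := [pred m : 'X_{1..n < t.+1} | reduced G rho m].
  have AB : A \proper B.
    apply/properP; split; first by apply/subsetP => m /andP[].
    exists (BMultinom lt_m0); first exact: rf.
    by rewrite inE /= eqxx andbF.
  exact: leq_trans (proper_card AB) (le_rs t).
have Js : J (\sum_y c y *: 'X_[val y]).
  rewrite -(@untwistK n rho R K (\sum_y _)); apply: (_ : J' _).
  have -> : untwist rho R (\sum_y c y *: 'X_[val y]) =
      \sum_y untwist rho R (c y *: 'X_[val y]) by exact: rmorph_sum.
  have -> : \sum_y untwist rho R (c y *: 'X_[val y]) =
      \sum_y untwist rho R (c y *: 'X_[val y]) - \sum_y c y *: h y.
    by rewrite sumh subr0.
  rewrite -sumrB; apply: ideal_sum => y _.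
  rewrite /untwist mpoly_evalZ -scalerBr -mul_mpolyC; apply: ideal_M.
  by case: (hP y).
have sum0 : \sum_y c y *: 'X_[val y] = 0 :> {mpoly K[n]}.
  apply/mpolyP => m; rewrite mcoeff0; apply/eqP; apply: contraT => sm.
  have Gm : above G m.
    exact: supported_neq0 (proj1 (monomial_idealP G _) Js) sm.
  case/negP: sm; rewrite raddf_sum /= big1 // => y _; rewrite mcoeffZ mcoeffX.
  case: eqP => [e|]; last by rewrite mulr0.
  by have := valP y; rewrite e Gm.
by move: cy0; rewrite (monomial_independent sum0 y0) eqxx.
Qed.

End Counting.
End Freeness.

(** * Cohen--Macaulayness and freeness *)

Lemma regular_mod_locally (A : comPzRingType) (M : primeIdeal A) (N : ideal A) s :
  regular_mod N s -> locally_regular M N s.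
Proof.
elim: s N => [|x s IHs] N //= [Nx rs]; split; last exact: IHs.
by move=> y /Nx Ny; exists 1; [apply: prime_proper | rewrite mul1r].
Qed.

Lemma localizes_automorphism (S L : comPzRingType) (J : ideal S) (M : primeIdeal S)
    (iota : {rmorphism S -> L}) (phi : {rmorphism S -> S}) (phi' : S -> S) :
  cancel phi' phi -> localizes J M iota ->
  localizes (contract phi J) (contract_prime phi M) (iota \o phi).
Proof.
move=> phiK loc; split=> [s Ms|x|f] /=.
- exact: (localizes_unit loc).
- have [f [s [Ms e]]] := localizes_frac loc x.
  by exists (phi' f), (phi' s); rewrite !phiK.
- split=> [/(localizes_ker loc)[u Mu Ju]|[u Mu Ju]].
    by exists (phi' u); rewrite ?rmorphM /= phiK.
  by apply/(localizes_ker loc); exists (phi u); rewrite // -rmorphM.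
Qed.

Lemma noetherian_quotient (A : comPzRingType) (I : ideal A) :
  noetherian A -> noetherian (quotient_ring I).
Proof.
move=> nA; apply: (noetherian_image (phi := @to_quotient A I)) nA _ => x.
by have [a ->] := to_quotient_surj x; exists a, 1, 1; rewrite !mul1r.
Qed.

Section CohenMacaulay.
Variables (n : nat) (G : seq 'X_{1..n}) (rho : 'I_n -> 'I_n) (R : {set 'I_n}).
Hypothesis rho_id : forall r, r \in R -> rho r = r.
Hypothesis rho_G : forall u a, u \in G -> u a != 0%N -> rho a \in R.
Hypothesis block_G : forall r, r \in R ->
  exists2 m, above G m & forall a, m a != 0%N -> rho a = r.
Variable K : fieldType.
Implicit Types (f g u : {mpoly K[n]}).
Local Notation J := (monomial_ideal K G).
Local Notation J' := (twisted_ideal G rho R K).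

(** A prime containing [J'] contains, for each block, one of the forms
    [x_a + x_(rho a)], so that the variables outside [R] generate modulo it. *)
Lemma generators_mod_prime (Q : primeIdeal {mpoly K[n]}) (X : {set 'I_n}) :
  subideal J' Q -> (forall a, a \in X -> Q 'X_a) ->
  forall a, exists2 g, poly_in (~: R :\: X) g & Q ('X_a - g).
Proof.
move=> JQ QX a.
have gen0 b : Q 'X_b -> exists2 g, poly_in (~: R :\: X) g & Q ('X_b - g).
  by move=> Qb; exists 0; [apply: poly_in0 | rewrite subr0].
have [aX|aX] := boolP (a \in X); first exact/gen0/QX.
have [aR|aR] := boolP (a \in R); last first.
  exists 'X_a; last by rewrite subrr; apply: ideal_0.
  by apply: poly_inX; rewrite !inE aX.
have [m Gm ma] := block_G aR.
have /JQ : J' (untwist rho R 'X_[m]).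
  by apply/twisted_untwist; apply: monomial_ideal_above.
rewrite /untwist mpoly_evalXm => /(@prime_prod _ Q)[b Qb].
have [mb|mb] := eqVneq (m b) 0%N.
  by move: Qb; rewrite mb expr0 => /(@prime_proper _ Q).
move/(@prime_exp _ Q): Qb; rewrite /representative (ma b mb) aR andbT.
case: ifP => [bR|/negbFE bR].
  have [bX|bX] := boolP (b \in X).
    by move=> Qba; apply: gen0; apply: ideal_DKr Qba; apply: QX.
  move=> Qba; exists (- 'X_b); last by rewrite opprK addrC.
  by apply: poly_inN; apply: poly_inX; rewrite !inE bX.
by have := ma b mb; rewrite rho_id // addr0 => -> /gen0.
Qed.

Section AtPrime.
Variables (L : comPzRingType) (M : primeIdeal {mpoly K[n]}).
Variable iota : {rmorphism {mpoly K[n]} -> L}.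
Hypothesis loc : localizes J' M iota.
Hypothesis JM : subideal J' M.

(** The bound on chains passes to the local ring by contraction. *)
Lemma local_chain_bound (X V : {set 'I_n}) (p : nat -> primeIdeal L) k :
  prime_chain p k -> (forall a, a \in X -> p 0%N (iota 'X_a)) ->
  independent_mod M V -> (k + #|V| <= #|~: R :\: X|)%N.
Proof.
move=> pc pX indV.
apply: (@chain_dimension _ _ (fun i => contract_prime iota (p i))).
- by move=> i /pc; apply: contract_strict loc _ _.
- by apply: generators_mod_prime => //; apply: contract_ge loc _.
- by move=> f Vf /(contract_le loc JM); apply: indV.
Qed.

(** The sequence of [local_parameters] has the length that bounds every chain of
    primes of the local ring, hence also every regular sequence. *)
Lemma free_local_cohen_macaulay : reduced_free G rho R K -> local_cohen_macaulay L.
Proof.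
move=> free; have [nf nfP] := reduced_free_normal_form rho_id rho_G free.
have noethL := localizes_noetherian loc (@hilbert_basis K n).
have [V [s [VR indV sizes Ms regs]]] := local_parameters nfP M.
pose P := local_prime loc JM.
have bound (p : nat -> primeIdeal L) k : prime_chain p k -> (k <= size s)%N.
  move=> pc; rewrite sizes leq_subRL ?subset_leq_card // addnC.
  have := @local_chain_bound set0 V p k pc _ indV; rewrite setD0; apply.
  by move=> a; rewrite inE.
pose t := map iota s.
have Pt x : x \in t -> P x.
  by move=> /mapP[f fs ->]; apply/local_prime_contract; apply: Ms.
have regt : regular_sequence t.
  apply/regular_sequenceE; split.
    have tP : subideal (ideal_seq t) P by apply: ideal_gen_le.
    by move=> /tP; apply: prime_proper.
  by rewrite -(extend_zero loc); apply/regular_mod_extend.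
have chain t' : (forall x, x \in t' -> P x) -> regular_sequence t' ->
    exists p : nat -> primeIdeal L, prime_chain p (size t').
  move=> Pt' /regular_sequenceE[_ regt'].
  have [||p [pc _ _]] := @regular_chain _ noethL P (zero_ideal L) t' _ Pt'.
  - by move=> x ->; apply: ideal_0.
  - exact: regular_mod_locally.
  by exists p.
exists P, (size s); split.
- exact: localizes_local.
- split; first by exists t; rewrite size_map.
  by move=> k [t' [<- Pt' /(chain _ Pt')[p]]]; apply: bound.
- split; last by move=> k [p]; apply: bound.
  by have [p] := chain _ Pt regt; rewrite size_map; exists p.
Qed.

(** Once the variables of [X] vanish modulo [N], the next variable [w] is regular
    modulo [N]: otherwise it lies in an associated prime, above which there is
    no room for the chain that the regular sequence produces. *)
Lemma variables_regular (ws : seq 'I_n) (X : {set 'I_n}) (N : ideal L) (s : seq L) :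
  noetherian L -> uniq ws -> {subset ws <= ~: R :\: X} -> size ws = #|~: R :\: X| ->
  (forall a, a \in X -> N (iota 'X_a)) ->
  (forall x, x \in s -> local_prime loc JM x) -> size s = size ws -> regular_mod N s ->
  (forall w, w \in ws -> M 'X_w) ->
  regular_mod N [seq iota 'X_w | w <- ws].
Proof.
move=> noethL; elim: ws X N s => [|w ws IHws] X N s //= /andP[w_ws uws] wsX sizews NX Ps
  sizes regs wsM.
have wX : w \in ~: R :\: X by apply: wsX; rewrite mem_head.
have cardwX : #|~: R :\: (w |: X)| = size ws.
  by move: sizews; rewrite (cardsD1 w) wX add1n setDDl setUC => -[].
have Nw : nonzerodivisor_mod N (iota 'X_w).
  move=> y Nwy; apply: boolp.contrapT => Ny.
  have [Q aQ colonQ] := associated_above noethL Ny.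
  have [p pc p0] := regular_chain_above noethL (@local_prime_unit _ _ _ _ _ loc JM)
    Ps regs aQ.
  have := @local_chain_bound (w |: X) set0 p (size s) pc _ (@independent0 _ _ M).
  rewrite cards0 addn0 cardwX sizes ltnn => H; apply: notF; apply: H => a.
  rewrite p0 !inE => /predU1P[->|/NX Na]; apply: colonQ => //=.
  by rewrite mulrC; apply: ideal_M.
have Pw : local_prime loc JM (iota 'X_w).
  by apply/local_prime_contract; apply: wsM; rewrite mem_head.
have [t [sizet Pt regt]] :=
  @regular_quotient _ noethL (local_prime loc JM) (local_prime loc JM) s N _ Ps regs Pw Nw.
split=> //; apply: (IHws (w |: X) _ t) => //.
- move=> v vws; have := wsX v; rewrite inE vws orbT => /(_ isT); rewrite !inE negb_or.
  by move=> /andP[-> ->]; rewrite !andbT; apply: contra w_ws => /eqP <-.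
- move=> a; rewrite !inE => /predU1P[->|/NX Na]; first exact: mem_add_ideal.
  exact: sub_add_ideal.
- by rewrite sizet sizes.
- by move=> v vws; apply: wsM; rewrite inE vws orbT.
Qed.

End AtPrime.

Theorem free_cohen_macaulay : reduced_free G rho R K -> cohen_macaulay (quotient_ring J).
Proof.
move=> free; split; first exact: noetherian_quotient (@hilbert_basis K n).
move=> M0 _.
have loc := localizes_automorphism (phi := @twist n rho R K)
  (@untwistK n rho R K) (quotient_localizes M0).
apply: (free_local_cohen_macaulay loc _ free) => f.
exact: (@quotient_contract_ge _ J M0).
Qed.

Lemma origin_twist f : origin_prime K n (twist rho R f) <-> origin_prime K n f.
Proof.
rewrite !origin_primeE.
suff /eqP : ((twist rho R f)@_0%MM)%:MP_[n] = (f@_0%MM)%:MP_[n].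
  by rewrite mpolyC_eq => /eqP ->.
rewrite -!eval_origin /twist mpoly_eval_comp; congr (mpoly_eval _ f).
apply: boolp.funext => a; rewrite mpoly_evalB mpoly_evalX /representative.
by case: ifP => _; rewrite ?mpoly_evalX ?rmorph0 subr0.
Qed.

Lemma origin_quotient_maximal (JO : subideal J (origin_prime K n)) :
  maximal_ideal (quotient_prime JO).
Proof.
split=> [|N ON N1 x]; first exact: prime_proper.
have [f ->] := to_quotient_surj x => Nf; apply: boolp.contrapT => Of; apply: N1.
have f0 : f@_0%MM != 0.
  by apply/eqP => f0; apply: Of; apply/quotient_primeE/origin_primeE.
have Nc : N (to_quotient J (f@_0%MM)%:MP).
  have : N (to_quotient J (f - (f@_0%MM)%:MP)).
    apply: ON; apply/quotient_primeE/origin_primeE.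
    by rewrite mcoeffB mcoeffC eqxx mulr1 subrr.
  by rewrite rmorphB /= => /(ideal_B Nf); rewrite opprB addrC subrK.
have : N (to_quotient J ((f@_0%MM)^-1%:MP) * to_quotient J (f@_0%MM)%:MP).
  exact: ideal_M.
by rewrite -rmorphM /= -mpolyCM mulVf // mpolyC1 rmorph1.
Qed.

(** [J] vanishes on the coordinate subspace of [V], which gives a chain of
    coordinate primes of length [#|V|] between [J] and the origin; so the local ring
    there has dimension, hence depth, at least [#|V|]. *)
Section CoordinateSubspace.
Variable V : {set 'I_n}.
Hypothesis card_V : (#|~: R| <= #|V|)%N.
Hypothesis V_G : forall u : 'X_{1..n}, u \in G -> exists2 a, a \notin V & u a != 0%N.

Let p i := coordinate_prime K (~: [set a in drop i (enum V)]).

Let coordinate_chain : prime_chain p #|V|.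
Proof.
move=> i iV; apply: coordinate_prime_lt.
rewrite properC; move: iV; rewrite cardE => iV.
have [a aE] : exists a, drop i (enum V) = a :: drop i.+1 (enum V).
  have a0 : 'I_n by move: (enum V) iV => [|a].
  by exists (nth a0 (enum V) i); apply: drop_nth.
apply/properP; rewrite aE; split.
  by apply/subsetP => b; rewrite !inE orbC => ->.
exists a; rewrite !inE ?eqxx //.
by have := drop_uniq i (enum_uniq V); rewrite aE /= => /andP[].
Qed.

Let J_p0 : subideal J (p 0%N).
Proof.
apply: ideal_gen_le => _ /mapP[u uG ->]; have [a aV ua] := V_G uG.
by apply: coordinate_prime_monomial ua; rewrite !inE drop0 mem_enum.
Qed.

Let J_origin : subideal J (origin_prime K n).
Proof. by move=> f /J_p0; apply: coordinate_prime_le; apply: subsetT. Qed.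

Theorem cohen_macaulay_free : cohen_macaulay (quotient_ring J) -> reduced_free G rho R K.
Proof.
move=> [_ /(_ _ (origin_quotient_maximal J_origin))[M1 [d [localM1 [[s [sizes M1s]] regs _]]]]].
move=> [_ dimL].
pose M0 := quotient_prime J_origin.
pose L := localization M0.
have loc := quotient_localizes M0.
pose M := contract_prime (@to_quotient _ J) M0.
have ME f : M f <-> origin_prime K n f by apply: quotient_primeE.
have JM : subideal J M by apply: quotient_contract_ge.
have noethL := localizes_noetherian loc (@hilbert_basis K n).
have [|q qc] := extend_chain loc JM coordinate_chain J_p0.
  move=> f pf; apply/ME; apply: coordinate_prime_le pf; exact: subsetT.
have le_Vd : (#|V| <= d)%N by apply: dimL; exists q.
have loc' := localizes_automorphism (phi := @twist n rho R K) (@untwistK n rho R K) loc.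
have JM' : subideal J' (contract_prime (@twist n rho R K) M) by move=> f; apply: JM.
have M1E := maximal_local_prime loc' JM' (proj1 localM1).
(* The regular sequence given by the depth may be longer than the number of
   variables outside [R]: only that many members are kept. *)
have [rs _] : regular_mod (zero_ideal L) (take #|~: R| s) /\
    regular_mod (add_ideals (zero_ideal L) (take #|~: R| s)) (drop #|~: R| s).
  by apply/regular_mod_cat; rewrite cat_take_drop; case/regular_sequenceE: regs.
have sizet : size (take #|~: R| s) = size (enum (~: R)).
  by rewrite size_takel -?cardE // sizes (leq_trans card_V).
have XM w : contract_prime (@twist n rho R K) M 'X_w.
  by apply/ME/origin_twist/coordinate_primeX; rewrite inE.
have reg := @variables_regular L _ _ loc' JM' (enum (~: R)) set0 _ (take #|~: R| s)
  noethL (enum_uniq _) _ _ _ _ sizet rs (fun w _ => XM w).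
apply: (locally_regular_free rho_id rho_G).
apply: (@locally_regularS _ (contract_prime (@twist n rho R K) M)).
  by move=> f Of; apply/ME/origin_twist.
apply/(regular_mod_extend loc') => //; rewrite (extend_zero loc') -map_comp.
apply: reg.
- by move=> w; rewrite mem_enum setD0.
- by rewrite setD0 -cardE.
- by move=> a; rewrite inE.
- by move=> x /mem_take xs; rewrite -M1E; apply: M1s.
Qed.

End CoordinateSubspace.
End CohenMacaulay.

(** Over [K] the reduced monomials are independent, which bounds their number by
    that of the monomials outside the ideal; over [K'] the same bound makes them
    independent. *)
Theorem cohen_macaulay_transfer (n : nat) (G : seq 'X_{1..n}) (rho : 'I_n -> 'I_n)
    (R V : {set 'I_n}) (K K' : fieldType) :
  (forall r, r \in R -> rho r = r) ->
  (forall u a, u \in G -> u a != 0%N -> rho a \in R) ->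
  (forall r, r \in R -> exists2 m, above G m & forall a, m a != 0%N -> rho a = r) ->
  (#|~: R| <= #|V|)%N -> (forall u, u \in G -> exists2 a, a \notin V & u a != 0%N) ->
  cohen_macaulay (quotient_ring (monomial_ideal K G)) ->
  cohen_macaulay (quotient_ring (monomial_ideal K' G)).
Proof.
move=> rho_id rho_G block_G card_V V_G cmK.
apply: (free_cohen_macaulay rho_id rho_G block_G).
apply: (count_reduced_free rho_id rho_G) => t.
apply: (@reduced_free_count _ _ _ R K).
exact: cohen_macaulay_free card_V V_G cmK.
Qed.

(** * Blocks of a regular sequence of monomials *)

Lemma monomial_ideal_X (K : fieldType) n (G : seq 'X_{1..n}) m :
  monomial_ideal K G 'X_[m] <-> above G m.
Proof.
split; last exact: monomial_ideal_above.
by move/monomial_idealP; apply; apply/mem_msuppXP.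
Qed.

Section RegularMonomials.
Variables (K : fieldType) (n : nat) (vs : seq 'X_{1..n}).
Hypothesis reg_vs : regular_sequence [seq 'X_[v] : {mpoly K[n]} | v <- vs].
Local Notation v_ := (nth 0%MM vs).

Lemma regular_monomials_neq0 i : (i < size vs)%N -> exists a, v_ i a != 0%N.
Proof.
move=> ivs; apply/existsP; rewrite -negb_forall; apply/negP => /forallP vi0.
case: reg_vs => + _; apply; rewrite -mpolyX0; apply/(monomial_ideal_X K vs).
apply/hasP; exists (v_ i); first exact: mem_nth.
by apply/mnm_lepP => a; rewrite (eqP (vi0 a)).
Qed.

Lemma regular_monomials_step i m : (i < size vs)%N ->
  above (take i vs) (v_ i + m) -> above (take i vs) m.
Proof.
move=> ivs /(monomial_ideal_X K) am; apply/(monomial_ideal_X K).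
case: reg_vs => _ /(_ i 'X_[m]); rewrite size_map -map_take => /(_ ivs); apply.
by rewrite (nth_map 0%MM) // -mpolyXD.
Qed.

(** If [a] occurs in [v_ i] and [v_ j], then [v_ j] times [v_ i / x_a] lies in the
    ideal of the members before [v_ j], so one of them divides [v_ i / x_a]. *)
Lemma regular_monomials_disjoint i j a : (i < j)%N -> (j < size vs)%N ->
  v_ i a != 0%N -> v_ j a != 0%N -> False.
Proof.
elim/ltn_ind: j i a => j IHj i a ij jvs via vja.
have /hasP[_ /(nthP 0%MM)[k + <-] le_ki] : above (take j vs) (v_ i - U_(a))%MM.
  apply: regular_monomials_step => //.
  apply/hasP; exists (v_ i).
    by apply/(nthP 0%MM); exists i; rewrite ?nth_take ?size_takel // ltnW.
  apply/mnm_lepP => b; rewrite mnmDE mnmBE mnm1E.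
  by have [<-|_] := eqVneq a b; lia.
rewrite size_takel ?(ltnW jvs) // => kj; rewrite nth_take // in le_ki.
have le_kib b : (v_ k b <= v_ i b)%N.
  by have := mnm_lepP le_ki b; rewrite mnmBE => /leq_trans; apply; apply: leq_subr.
have kvs : (k < size vs)%N by apply: ltn_trans jvs.
have [b vkb] := regular_monomials_neq0 kvs.
have vib : v_ i b != 0%N by have := le_kib b; lia.
have [ki|ik|eq_ki] := ltngtP k i.
- exact: (IHj i ij k b ki (ltn_trans ij jvs) vkb vib).
- exact: (IHj k kj i b ik kvs vib vkb).
- have := mnm_lepP le_ki a; rewrite eq_ki mnmBE mnm1E eqxx /=; move: via; lia.
Qed.

(** The block of [v_ i] consists of its variables; variables outside all supports
    join the first block.  If the sequence is empty then [V] is everything and [G] is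
    empty, so nothing has to be identified. *)
Lemma regular_monomials_blocks (V : {set 'I_n}) (G : seq 'X_{1..n}) :
  (forall v, v \in vs -> above G v) ->
  (n - size vs <= #|V|)%N -> (forall u, u \in G -> exists2 a, a \notin V & u a != 0%N) ->
  exists (rho : 'I_n -> 'I_n) (R : {set 'I_n}),
  [/\ forall r, r \in R -> rho r = r,
      forall u a, u \in G -> u a != 0%N -> rho a \in R,
      forall r, r \in R -> exists2 m, above G m & forall a, m a != 0%N -> rho a = r
    & (#|~: R| <= #|V|)%N].
Proof.
move=> Gvs card_V V_G; have [vs0|vs_gt0] := posnP (size vs).
  have VT : V = setT.
    by apply/eqP; rewrite eqEcard subsetT cardsT card_ord; rewrite vs0 subn0 in card_V.
  exists id, set0; split=> // [u a /V_G[b]|r|]; rewrite ?inE //.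
    by rewrite VT inE.
  by rewrite VT; apply: subset_leq_card; apply: subsetT.
have [|rep repP] := boolp.choice (P := fun i a => (i < size vs)%N -> v_ i a != 0%N).
  move=> i; have [/regular_monomials_neq0[a va]|nlt] := boolP (i < size vs)%N.
    by exists a.
  by have [a _] := regular_monomials_neq0 vs_gt0; exists a.
pose idx a := find (fun v : 'X_{1..n} => v a != 0%N) vs.
pose rho a := if (idx a < size vs)%N then rep (idx a) else rep 0%N.
pose R := [set a in [seq rep i | i <- iota 0 (size vs)]].
have idxP i a : (i < size vs)%N -> v_ i a != 0%N -> idx a = i.
  move=> ivs via.
  have hasa : has (fun v : 'X_{1..n} => v a != 0%N) vs.
    by apply/hasP; exists (v_ i) => //; apply: mem_nth.
  have idx_lt : (idx a < size vs)%N by rewrite /idx -has_find.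
  have idx_a : v_ (idx a) a != 0%N by apply: (nth_find 0%MM hasa).
  case: (ltngtP (idx a) i) => // lt.
    by case: (regular_monomials_disjoint lt ivs idx_a via).
  by case: (regular_monomials_disjoint lt idx_lt via idx_a).
have rhoP i a : (i < size vs)%N -> v_ i a != 0%N -> rho a = rep i.
  by move=> ivs via; rewrite /rho (idxP i a ivs via) ivs.
have inR i : (i < size vs)%N -> rep i \in R.
  by move=> ivs; rewrite inE; apply: map_f; rewrite mem_iota.
have RP r : r \in R -> exists2 i, (i < size vs)%N & r = rep i.
  by rewrite inE => /mapP[i]; rewrite mem_iota => /andP[_ ivs] ->; exists i.
exists rho, R; split.
- by move=> r /RP[i ivs ->]; apply: rhoP => //; apply: repP.
- by move=> u a _ _; rewrite /rho; case: ifP => [/inR //|_]; apply: inR.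
- move=> r /RP[i ivs ->]; exists (v_ i); first by apply: Gvs; apply: mem_nth.
  by move=> a; apply: rhoP.
- rewrite cardsCs setCK card_ord; apply: leq_trans card_V; rewrite leq_sub2l //.
  rewrite cardsE; have /card_uniqP-> : uniq [seq rep i | i <- iota 0 (size vs)].
    rewrite map_inj_in_uniq ?iota_uniq // => i j; rewrite !mem_iota /= !add0n => ivs jvs e.
    by rewrite -(idxP i (rep i) ivs (repP i ivs)) e (idxP j (rep j) jvs (repP j jvs)).
  by rewrite size_map size_iota.
Qed.

End RegularMonomials.

(** * Independent variables modulo an initial ideal *)

Section InitialIdeal.
Variables (n : nat) (le : rel 'X_{1..n}).
Hypothesis le_order : monomial_order le.

Lemma last_sort_max (T : eqType) (r : rel T) (x0 : T) (s : seq T) :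
  transitive r -> total r -> s != [::] ->
  last x0 (sort r s) \in s /\ forall y, y \in s -> r y (last x0 (sort r s)).
Proof.
move=> r_trans r_total s0.
have mem_s := mem_sort r s; have sorted_s := sort_sorted r_total s.
have [t [x e]] : exists t x, sort r s = rcons t x.
  case/lastP: (sort r s) (size_sort r s) => [/esym/eqP|t x _]; last by exists t, x.
  by rewrite size_eq0 (negPf s0).
rewrite e last_rcons; split; first by rewrite -mem_s e mem_rcons mem_head.
move=> y; rewrite -mem_s e mem_rcons inE => /predU1P[->|yt].
  by have := r_total x x; rewrite orbb.
have := sorted_s; rewrite e sorted_pairwise // -cats1 pairwise_cat => /and3P[+ _ _].
by move=> /allrelP/(_ y x yt); apply; rewrite mem_head.
Qed.

Lemma init_monP (K : fieldType) (f : {mpoly K[n]}) : f != 0 ->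
  init_mon le f \in msupp f /\ forall m, m \in msupp f -> le m (init_mon le f).
Proof.
rewrite -msupp_eq0; apply: last_sort_max; [exact: mo_trans le_order | exact: mo_total le_order].
Qed.

Lemma mcoeff_pihomog (K : fieldType) (f : {mpoly K[n]}) d m :
  (pihomog mdeg d f)@_m = if mdeg m == d then f@_m else 0.
Proof.
have -> : (if mdeg m == d then f@_m else 0) =
    \sum_(m' <- msupp f) (if mdeg m == d then (f@_m' *: 'X_[m'])@_m else 0).
  case: ifP => _; first by rewrite {1}[f]mpolyE raddf_sum.
  by rewrite big1.
rewrite pihomogE raddf_sum /= big_mkcond; apply: eq_bigr => m' _.
rewrite mcoeffZ mcoeffX; have [->|_] := eqVneq m' m; first by [].
by rewrite mulr0 !if_same.
Qed.

Section FixedField.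
Variables (K : fieldType) (I : ideal {mpoly K[n]}) (G : seq 'X_{1..n}).
Hypothesis gradedI : graded_ideal I.
Hypothesis init_G : forall f, init_ideal le I f <-> monomial_ideal K G f.

(** An element of [I] whose initial monomial divides [m] is made homogeneous and
    multiplied by the missing factor. *)
Lemma init_ideal_lift m : above G m -> exists g, [/\ I g, g@_m != 0 &
  supported (fun m' => le m' m /\ mdeg m' <= mdeg m)%N g].
Proof.
move=> /(monomial_ideal_X K)/init_G Im.
pose U m := exists f, [/\ I f, f != 0 & (init_mon le f <= m)%MM].
have U_up m1 m2 : U m2 -> U (m1 + m2)%MM.
  by move=> [f [If f0 fm]]; exists f; split=> //; apply: lepm_trans fm (lem_addl _ _).
have : monomial_span K U_up 'X_[m].
  move: Im; apply: ideal_gen_le => _ [f [If f0 ->]].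
  by apply: supportedX; exists f; split=> //; apply: lepm_refl.
move=> /(_ m); rewrite msuppX mem_head => /(_ isT)[f [If f0 fm]].
have [inf maxf] := init_monP f0; set v := init_mon le f in fm inf maxf.
pose d := (m - v)%MM; have mE : m = (d + v)%MM by rewrite submK.
(* The homogeneous component of [f] in the degree of its initial monomial has the
   same initial monomial, and lies in [I] because [I] is graded. *)
exists (pihomog mdeg (mdeg v) f * 'X_[d]); split.
- by apply: ideal_Mr; apply: gradedI.
- by rewrite mE mcoeffMX mcoeff_pihomog eqxx -mcoeff_msupp.
- have hf : supported (fun m' => le m' v /\ mdeg m' = mdeg v) (pihomog mdeg (mdeg v) f).
    move=> m'; rewrite mcoeff_msupp mcoeff_pihomog; case: ifP => [/eqP dm|_].
      by rewrite -mcoeff_msupp => /maxf.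
    by rewrite eqxx.
  have dX : supported (fun m' => m' = d) ('X_[d] : {mpoly K[n]}) by apply: supportedX.
  apply: supportedM hf dX => m1 _ [le1 deg1] ->.
  rewrite mE addmC !mdegD deg1; split; last by [].
  by rewrite [(d + v)%MM]addmC addmC; apply: (mo_add le_order).
Qed.

Section Counting.
Variable V : {set 'I_n}.
Hypothesis indV : independent_mod I V.
Hypothesis meets : forall V' : {set 'I_n}, (#|V| <= #|V'|)%N ->
  exists2 u, u \in G & mono_in V' u.

Let D := (\max_(u <- G) mdeg u)%N.
Let large (m : 'X_{1..n}) : {set 'I_n} := [set a | (D <= m a)%N].

(** Otherwise some [u] in [G] involves only large variables of [m] and divides
    [m]. *)
Lemma few_large m : ~~ above G m -> (#|large m| < #|V|)%N.
Proof.
rewrite ltnNge; apply: contra => /meets[u uG Vu]; apply/hasP; exists u => //.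
apply/mnm_lepP => a; have [->//|/Vu] := eqVneq (u a) 0%N.
rewrite inE => /(leq_trans _); apply; apply: (@leq_trans (mdeg u)).
  by rewrite mdegE (bigD1 a) //= leq_addr.
exact: (leq_bigmax_seq (F := fun u => mdeg u)).
Qed.

Lemma dim_pos : (0 < #|V|)%N.
Proof.
rewrite lt0n; apply/eqP => V0; have [|u uG u0] := meets (V' := set0); first by rewrite V0.
have uE : u = 0%MM.
  apply/mnmP => a; rewrite mnm0E; apply/eqP; apply: contraT => /u0; by rewrite inE.
have [|g [Ig gu gsup]] := @init_ideal_lift 0%MM.
  by apply/hasP; exists u; rewrite // uE; apply: lepm_refl.
case/eqP: gu; suff -> : g = 0 by rewrite mcoeff0.
apply: indV Ig => m /gsup[_]; rewrite mdeg0 leqn0 mdeg_eq0 => /eqP-> a.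
by rewrite mnm0E.
Qed.

(** A monomial outside the initial ideal has fewer than [#|V|] large exponents:
    it is determined by its small exponents and by the list of its large ones. *)
Lemma card_standard t : (#|[pred m : 'X_{1..n < t.+1} | ~~ above G m]| <=
  D.+1 ^ n * t.+1 ^ #|V|.-1)%N.
Proof.
have [a0 _] : exists a0, a0 \in V by apply/card_gt0P; apply: dim_pos.
pose T := {m : 'X_{1..n < t.+1} | ~~ above G m}.
pose code (m : T) : {ffun 'I_n -> 'I_D.+1} * {ffun 'I_#|V|.-1 -> 'I_t.+1} :=
  ([ffun a => inord (minn (bmnm (val m) a) D)],
   [ffun i : 'I_#|V|.-1 => inord (bmnm (val m) (nth a0 (enum (large (bmnm (val m)))) i))]).
have code_inj : injective code.
  move=> m1 m2 [] /ffunP e1 /ffunP e2; apply/val_inj/val_inj/mnmP => a.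
  have small b : minn (bmnm (val m1) b) D = minn (bmnm (val m2) b) D.
    have := congr1 val (e1 b); rewrite !ffunE /= !inordK //; by rewrite ltnS geq_minr.
  have eq_large : large (bmnm (val m1)) = large (bmnm (val m2)).
    by apply/setP => b; rewrite !inE; have := small b; lia.
  have [la|la] := boolP (a \in large (bmnm (val m1))); last first.
    have la2 : a \notin large (bmnm (val m2)) by rewrite -eq_large.
    move: la la2; rewrite !inE -!ltnNge => /ltnW/minn_idPl l1 /ltnW/minn_idPl l2.
    by have := small a; rewrite l1 l2.
  have lt_i : (index a (enum (large (bmnm (val m1)))) < #|V|.-1)%N.
    have := few_large (valP m1); rewrite cardE.
    have : (index a (enum (large (bmnm (val m1)))) < size (enum (large (bmnm (val m1)))))%N.
      by rewrite index_mem mem_enum.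
    by lia.
  have := congr1 val (e2 (Ordinal lt_i)); rewrite !ffunE /= -eq_large.
  rewrite nth_index ?mem_enum //.
  have le_t (m : 'X_{1..n < t.+1}) : (bmnm m a < t.+1)%N.
    apply: leq_ltn_trans (bmdeg m); rewrite mdegE (bigD1 a) //= leq_addr //.
  by rewrite !inordK.
have := leq_card code code_inj.
by rewrite card_sig card_prod !card_ffun !card_ord.
Qed.

(** In degrees at most [t] there are the monomials in the variables of [V], of
    order [t ^ #|V|], and the lifts of the monomials of the initial ideal.  The
    monomials that remain are of smaller order, so these polynomials are linearly
    dependent.  Independence of [V] modulo [I] leaves a relation between the lifts,
    whose initial monomials are distinct. *)
Lemma too_many_independent : False.
Proof.
pose e := #|V|; have e_gt0 : (0 < e)%N := dim_pos.
have [|s lts] := @polynomial_growth e (D.+1 ^ n) e.-1 e; first by rewrite prednK.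
pose t := (e * s)%N.
pose A := {b : {ffun 'I_n -> 'I_s.+1} | b \in pffun_on ord0 (mem V) predT}.
pose B := {m : 'X_{1..n < t.+1} | above G m}.
pose mon (b : A) : 'X_{1..n} := [multinom (val b i : nat) | i < n].
have [|g gP] := boolp.choice (P := fun (m : B) g => [/\ I g, g@_(bmnm (val m)) != 0 &
    supported (fun m' => le m' (bmnm (val m)) /\ mdeg m' <= mdeg (bmnm (val m)))%N g]).
  by move=> m; apply: init_ideal_lift; apply: (valP m).
pose F (j : A + B) : {mpoly K[n]} := match j with inl b => 'X_[mon b] | inr m => g m end.
pose E := image (@bmnm n t.+1) predT.
have monV b : mono_in V (mon b).
  move=> a; rewrite mnmE => ba; have /pffun_onP[/subsetP sV _] := valP b.
  by apply: sV; rewrite inE; apply: contra ba => /eqP->.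
have mon_deg b : (mdeg (mon b) <= t)%N.
  rewrite mdegE (bigID (mem V)) /= [X in (_ + X)%N]big1 ?addn0.
    rewrite /t /e -sum_nat_const; apply: leq_sum => a _.
    by rewrite mnmE -ltnS ltn_ord.
  by move=> a aV; apply/eqP; apply: contraT => /monV; rewrite (negPf aV).
have FE j : supported (fun m => m \in E) (F j).
  suff degF : supported (fun m => mdeg m < t.+1)%N (F j).
    by apply: supportedS degF => m dm; apply/imageP; exists (BMultinom dm).
  case: j => [b|m] /=; first by apply: supportedX; rewrite ltnS.
  have [_ _] := gP m; apply: supportedS => m' [_ dm'].
  exact: leq_ltn_trans dm' (bmdeg _).
have [|c [[j0 cj0] sumF]] := linear_relation FE.
  rewrite size_image card_sum !card_sig.
  have -> : #|[pred b | b \in pffun_on (ord0 : 'I_s.+1) (mem V) predT]| = (s.+1 ^ e)%N.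
    by rewrite (eq_card (B := pffun_on ord0 (mem V) predT)) // card_pffun_on card_ord.
  have -> : #|@predT 'X_{1..n < t.+1}| = (#|[pred m : 'X_{1..n < t.+1} | above G m]| +
      #|[pred m : 'X_{1..n < t.+1} | ~~ above G m]|)%N.
    by rewrite -(cardC [pred m : 'X_{1..n < t.+1} | above G m]).
  rewrite addnC ltn_add2r; exact: leq_ltn_trans (card_standard t) lts.
pose a := \sum_b c (inl b) *: 'X_[mon b] : {mpoly K[n]}.
pose b := \sum_m c (inr m) *: g m.
have ab0 : a + b = 0 by rewrite -sumF big_sumType.
have Ib : I b.
  apply: ideal_sum => m _; rewrite -mul_mpolyC; apply: ideal_M.
  by have [] := gP m.
have a0 : a = 0.
  apply: indV.
    by apply: supported_sum => j _; apply: supportedZ; apply: supportedX; apply: monV.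
  by rewrite -[a](addrK b) ab0 add0r; apply: ideal_N.
have b0 : b = 0 by move: ab0; rewrite a0 add0r.
have mon_inj : injective mon.
  move=> b1 b2 /mnmP eq_mon; apply/val_inj/ffunP => i; apply/val_inj.
  by have := eq_mon i; rewrite !mnmE.
have cl j : c (inl j) = 0.
  move/mpolyP/(_ (mon j)): a0; rewrite mcoeff0 /a raddf_sum (bigD1 j) //=.
  rewrite mcoeffZ mcoeffX eqxx mulr1 big1 ?addr0 // => i ne.
  by rewrite mcoeffZ mcoeffX (inj_eq mon_inj) (negPf ne) mulr0.
(* The relation among the lifts [g m] has no term at the largest [m] that
   occurs. *)
have [m1 cm1] : exists m, c (inr m) != 0.
  by case: j0 cj0 => [j|m] cj; [rewrite cl eqxx in cj | exists m].
pose ms := [seq bmnm (val m) | m <- [seq m <- enum {: B} | c (inr m) != 0]].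
have ms0 : ms != [::].
  have : bmnm (val m1) \in ms by apply/mapP; exists m1; rewrite // mem_filter cm1 mem_enum.
  by case: ms.
have [mem_top top_max] := last_sort_max 0%MM (mo_trans le_order) (mo_total le_order) ms0.
set top := last _ _ in mem_top top_max.
have /mapP[m2] := mem_top; rewrite mem_filter => /andP[cm2 _] topE.
move/mpolyP/(_ top): b0; rewrite mcoeff0 /b raddf_sum (bigD1 m2) //= big1 ?addr0.
  rewrite mcoeffZ topE => /eqP; rewrite mulf_eq0 (negPf cm2) /=.
  by have [_ /negPf->] := gP m2.
move=> m ne; rewrite mcoeffZ; have [->|cm] := eqVneq (c (inr m)) 0; first by rewrite mul0r.
have [_ _ gsup] := gP m; apply/eqP; rewrite mulf_eq0 (negPf cm) /=; apply: contraT => gtop.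
have [le_top _] := supported_neq0 gsup gtop.
have le_m : le (bmnm (val m)) top.
  by apply: top_max; apply/mapP; exists m; rewrite // mem_filter cm mem_enum.
case/eqP: ne; apply/val_inj/val_inj => /=; rewrite -topE.
by apply: (mo_anti le_order); rewrite le_m le_top.
Qed.

End Counting.

Lemma init_independent V : independent_mod I V ->
  exists V' : {set 'I_n}, (#|V| <= #|V'|)%N /\
    forall u, u \in G -> exists2 a, a \notin V' & u a != 0%N.
Proof.
move=> indV; apply: boolp.contrapT => noV; apply: (too_many_independent indV) => V' cardV'.
apply: boolp.contrapT => nou; apply: noV; exists V'; split=> // u uG.
apply: boolp.contrapT => noa; apply: nou; exists u => // a ua.
by apply: contraT => aV; case: noa; exists a.
Qed.

End FixedField.
End InitialIdeal.

(** * Ideals of König type *)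

Lemma identity_normal_form (K : fieldType) n :
  normal_form (zero_ideal {mpoly K[n]}) setT id.
Proof. by split=> // f; rewrite subrr. Qed.

(** The polynomials of [local_parameters] generate a chain of primes below [P]. *)
Lemma independent_height (K : fieldType) n (P : primeIdeal {mpoly K[n]}) h :
  prime_height P h -> exists2 V, independent_mod P V & (n - #|V| <= h)%N.
Proof.
move=> [_ maxh].
have [V [s [_ indV sizes Ps regs]]] := local_parameters (@identity_normal_form K n) P.
have [|p [pc pP _]] := regular_chain (@hilbert_basis K n) _ Ps regs.
  by move=> f ->; apply: ideal_0.
rewrite cardsT card_ord in sizes.
by exists V => //; rewrite -sizes; apply: maxh; exists p.
Qed.

Theorem corollary1p11 (K : fieldType) (n : nat) (le : rel 'X_{1..n})
    (I : ideal {mpoly K[n]}) (G : seq 'X_{1..n}) :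
  monomial_order le ->
  graded_ideal I ->
  konig_type le I ->
  minimal_generators [seq ('X_[u] : {mpoly K[n]})%R | u <- G]
    (init_ideal le I) ->
  forall K' : fieldType,
    cohen_macaulay (quotient_ring (monomial_ideal K' G)) <->
    cohen_macaulay (quotient_ring (init_ideal le I)).
Proof.
move=> le_order gradedI [h [fs [gs [[[P IP heightP] _] sizefs _ [gensI _] regfs]]]] [gensG _] K'.
have init_G f : init_ideal le I f <-> monomial_ideal K G f by split=> /gensG.
rewrite (ideal_ext init_G).
have [V0 indP card_V0] := independent_height heightP.
have indI : independent_mod I V0 by move=> f Vf /IP; apply: indP.
have [V [card_V V_G]] := init_independent le_order gradedI init_G indI.
pose vs := [seq init_mon le f | f <- fs].
have reg_vs : regular_sequence [seq 'X_[v] : {mpoly K[n]} | v <- vs].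
  by rewrite -map_comp.
have G_vs v : v \in vs -> above G v.
  move=> /mapP[f f_fs ->]; apply/(monomial_ideal_X K)/init_G; apply: mem_ideal_gen.
  exists f; split=> //.
    by apply/gensI; apply: mem_ideal_gen; rewrite mem_cat f_fs.
  (* The initial monomial of [0] is [1] by convention, and a regular sequence
     generates a proper ideal. *)
  apply/eqP => f0; case: reg_vs => + _; apply; apply: mem_ideal_gen.
  apply/mapP; exists (init_mon le f); first exact: map_f.
  by rewrite f0 /init_mon msupp0 mpolyX0.
have card_vs : (n - size vs <= #|V|)%N.
  by rewrite size_map sizefs; apply: leq_trans card_V; lia.
have [rho [R [rho_id rho_G block_G card_R]]] :=
  regular_monomials_blocks reg_vs G_vs card_vs V_G.
by split; apply: cohen_macaulay_transfer rho_id rho_G block_G card_R V_G.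
Qed.
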